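(* Let $X_1,X_2,\dots$ be independent random variables with $\mathbb{E}X_i=0$ and $\mathbb{E}X_i^2=\sigma^2\in(0,\infty)$, and let $N\sim\mathrm{Geo}(p)$, $p\in(0,1)$, be independent of the $X_i$. Let $W=p^{1/2}\sum_{i=1}^NX_i$ and $Z\sim\mathrm{Laplace}(0,\sigma/\sqrt2)$. Then $$d_{\mathrm K}(W,Z)\le17.04\frac{p^{1/2}}\sigma\sup_{i\ge1}\|F_{X_i}^{-1}-F_{X_i^L}^{-1}\|.$$ If in addition $\rho=\sup_{i\ge1}\mathbb{E}|X_i|^3<\infty$, then $$d_{\mathrm W}(W,Z)\le12p^{1/2}\Big(\sigma+\frac\rho{3\sigma^2}\Big).$$ Moreover, the order $p^{1/2}$ in the Wasserstein bound cannot be improved in general: if the $X_i$ are i.i.d. with moments of all orders and $\mathbb{E}X_1^3\neq0$, then $d_{\mathrm W}(W,Z)\ge cp^{1/2}$ for some $c>0$ and all sufficiently small $p$.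
   Context: $\mathrm{Geo}(p)$ is the distribution with $\mathbb{P}(N=k)=p(1-p)^{k-1}$, $k\ge1$. For $b>0$, $\mathrm{Laplace}(0,b)$ has density $\frac1{2b}e^{-|x|/b}$. For a mean-zero random variable $X$ with finite nonzero variance, $X^L$ has the $X$-centered equilibrium distribution if $\mathbb{E}f(X)-f(0)=\frac12\mathbb{E}X^2\,\mathbb{E}f''(X^L)$ for all twice-differentiable $f$ for which the expectations exist. $F_X$ is the distribution function of $X$, $F_X^{-1}$ its generalized inverse, and $\|F_X^{-1}-F_Y^{-1}\|=\sup_{u\in(0,1)}|F_X^{-1}(u)-F_Y^{-1}(u)|$. $d_{\mathrm K}$ is the Kolmogorov distance and $d_{\mathrm W}$ the Wasserstein distance (sup over Lipschitz test functions with constant $\le1$). *)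

(* Defs.v *)
From HB Require Import structures.
From mathcomp Require Import all_boot all_order all_algebra.
From mathcomp Require Import all_classical all_reals all_analysis.
Set Implicit Arguments. Unset Strict Implicit. Unset Printing Implicit Defensive.
Import Order.TTheory GRing.Theory Num.Theory.
Import numFieldNormedType.Exports.
Local Open Scope classical_set_scope.
Local Open Scope ring_scope.

Section Defs.
Context {R : realType}.

Definition mutually_independent {d} {T : measurableType d} (P : probability T R)
  {I : eqType} (Y : I -> T -> R) : Prop :=
  forall (J : seq I) (B : I -> set R), uniq J ->
    (forall j, j \in J -> measurable (B j)) ->
    P (\bigcap_(j in [set j | j \in J]) (Y j @^-1` B j)) =
    (\prod_(j <- J) P (Y j @^-1` B j))%E.

Definition geometric_rv {d} {T : measurableType d} (P : probability T R)
  (N : T -> nat) (p : R) : Prop :=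
  (forall k, measurable (N @^-1` [set k])) /\
  (forall k, (0 < k)%N -> P (N @^-1` [set k]) = (p * (1 - p) ^+ k.-1)%:E).

(* The random sum W = p^{1/2} sum_{i=1}^N X_i  (X 0 plays the role of X_1). *)
Definition random_sum {d} {T : measurableType d} (X : nat -> T -> R)
  (N : T -> nat) (p : R) : T -> R :=
  fun w => Num.sqrt p * \sum_(i < N w) X i w.

Definition laplace_pdf (b : R) (x : R) : R := (2 * b)^-1 * expR (- (`|x| / b)).

Definition laplace_cdf (b : R) (x : R) : \bar R :=
  (\int[lebesgue_measure]_(y in `]-oo, x]) (laplace_pdf b y)%:E)%E.

Definition laplace_expect (b : R) (h : R -> R) : \bar R :=
  (\int[lebesgue_measure]_y (h y * laplace_pdf b y)%:E)%E.

Definition dK_laplace {d} {T : measurableType d} (P : probability T R)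
  (W : T -> R) (b : R) : \bar R :=
  ereal_sup (range (fun x : R => (`| P [set w | (W w <= x)%R] - laplace_cdf b x |)%E)).

Definition lipschitz1 (h : R -> R) : Prop :=
  forall x y, `|h x - h y| <= `|x - y|.

Definition dW_laplace {d} {T : measurableType d} (P : probability T R)
  (W : T -> R) (b : R) : \bar R :=
  ereal_sup [set (`| 'E_P[h \o W] - laplace_expect b h |)%E | h in lipschitz1].

Definition cdf_rv {d} {T : measurableType d} (P : probability T R)
  (X : T -> R) (x : R) : R := fine (P [set w | X w <= x]).

Definition cdf_law (L : probability R R) (x : R) : R := fine (L [set y | (y <= x)%R]).

Definition gen_inv (F : R -> R) (u : R) : R := inf [set x | u <= F x].

(* L is the law of X^L, the X-centered equilibrium distribution of X:
   E f(X) - f(0) = 1/2 E X^2 E f''(X^L) for all twice differentiable f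
   for which the expectations exist. *)
Definition equilibrium_law {d} {T : measurableType d} (P : probability T R)
  (X : T -> R) (L : probability R R) : Prop :=
  forall f : R -> R,
    (forall x, derivable f x 1) -> (forall x, derivable (derive1 f) x 1) ->
    P.-integrable setT (fun w => (f (X w))%:E) ->
    L.-integrable setT (fun x => (derive1 (derive1 f) x)%:E) ->
    ('E_P[f \o X] - (f 0)%:E =
       (2^-1)%:E * 'E_P[fun w => (X w ^+ 2)%R] * \int[L]_x (derive1 (derive1 f) x)%:E)%E.

End Defs.

(* Main.v *)
Require Import Defs.
From HB Require Import structures.
From mathcomp Require Import all_boot all_order all_algebra.
From mathcomp Require Import all_classical all_reals all_analysis.
From mathcomp Require Import measurable_realfun.
From mathcomp Require Import ring lra.
Import Order.TTheory GRing.Theory Num.Theory.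
Import numFieldNormedType.Exports.
Set Implicit Arguments.
Unset Strict Implicit.
Unset Printing Implicit Defensive.
Local Open Scope classical_set_scope.
Local Open Scope ereal_scope.
Local Open Scope ring_scope.

(** Let [Z] be Laplace with parameter [b].  The function [f x = E h(x + Z)]
    solves [f - b^2 f'' = h] and [f 0 = E h(Z)].  By the memorylessness of the
    geometric law, [E f(S_(N-1)) = p f 0 + (1 - p) E f(S_N)] for the random sum
    [S_N], hence [E (f(S_N) - f(S_(N-1))) = p (E f(S_N) - f 0)].  Thus
    [p (E h(S_N) - E h(Z))] is an average over [j] of the one-step quantities
    [E (f(S_j + X_j) - f(S_j) - p (f - h)(S_j + X_j))].

    Wasserstein: Taylor-expand the step; [f''] is [2 / b^2]-Lipschitz.

    Kolmogorov: [h] is a ramp; the equilibrium law turns the step into [p] times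
    the difference of the expectations of [f - h] shifted by [X_j^L] and by
    [X_j], which are coupled by their quantiles.  The monotone [h] varies by at
    most [psi = h(. - e) - h(. + e)] under a shift by [e], and
    [psi = phi - b^2 phi''] for the small function [phi = f(. - e) - f(. + e)].
    So the error terms in [psi] are themselves one-step increments of [phi], and
    they sum up to an increment of [E phi].

    Lower bound: [E sin Z = 0], while [E sin] and [E cos] of the random sum
    solve a linear system whose coefficients are [E sin (sqrt p X_1)], of exact
    order [p^(3/2)], and [E cos (sqrt p X_1)], which is [1 - O(p)]. *)

(** * Real functions *)

Section lipschitz_functions.
Context {R : realType}.
Implicit Types (f g h : R -> R) (C D : R).

Lemma klipschitzP C f :
  C.-lipschitz f <-> forall x y, `|f x - f y| <= C * `|x - y|.
Proof. by split => [fC x y|fC [x y] _]; [exact: (fC (x, y))|exact: fC]. Qed.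

Lemma klipschitz_continuous C f : C.-lipschitz f -> continuous f.
Proof.
move=> /klipschitzP fC x; apply/cvgrPdist_lt => e e0.
have C1 : 0 < `|C| + 1 by rewrite ltr_wpDl.
near=> y; apply: le_lt_trans (fC x y) _.
have : `|x - y| < e / (`|C| + 1).
  near: y; apply: (@cvgr_dist_lt _ _ _ (nbhs x) _ id x) => //.
  by rewrite divr_gt0.
rewrite ltr_pdivlMr// mulrC; apply: le_lt_trans.
by rewrite ler_wpM2r// (le_trans (ler_norm C))// lerDl.
Unshelve. all: by end_near. Qed.

Lemma klipschitz_measurable C f : C.-lipschitz f -> measurable_fun [set: R] f.
Proof.
by move=> fC; apply: continuous_measurable_fun; exact: klipschitz_continuous fC.
Qed.

Lemma klipschitz_linear_growth C f x :
  C.-lipschitz f -> `|f x| <= `|f 0| + C * `|x|.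
Proof.
move=> /klipschitzP fC; rewrite -[f x](subrK (f 0)) addrC.
by rewrite (le_trans (ler_normD _ _))// lerD2l -[in leRHS](subr0 x).
Qed.

Lemma klipschitzB C D f g :
  C.-lipschitz f -> D.-lipschitz g -> (C + D).-lipschitz (f \- g).
Proof.
move=> /klipschitzP fC /klipschitzP gD; apply/klipschitzP => x y /=.
have -> : f x - g x - (f y - g y) = (f x - f y) - (g x - g y) by ring.
by rewrite mulrDl (le_trans (ler_normB _ _))// lerD.
Qed.

Lemma klipschitzZl C k f :
  C.-lipschitz f -> (`|k| * C).-lipschitz (fun x => k * f x).
Proof.
move=> /klipschitzP fC; apply/klipschitzP => x y.
by rewrite -mulrBr normrM -mulrA ler_wpM2l.
Qed.

Lemma klipschitz_norm : 1.-lipschitz (fun x : R => `|x|).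
Proof. by apply/klipschitzP => x y; rewrite mul1r ler_dist_dist. Qed.

Lemma klipschitz_translate C f c :
  C.-lipschitz f -> C.-lipschitz (fun x => f (x + c)).
Proof.
move=> /klipschitzP fC; apply/klipschitzP => x y; apply: le_trans (fC _ _) _.
by rewrite opprD addrACA subrr addr0.
Qed.

Lemma klipschitz_reflect C f : C.-lipschitz f -> C.-lipschitz (f \o -%R).
Proof.
move=> /klipschitzP fC; apply/klipschitzP => x y.
by rewrite (le_trans (fC _ _))// -opprD normrN.
Qed.

End lipschitz_functions.

Section derivatives.
Context {R : realType}.
Implicit Types f df : R -> R.

Lemma is_derive_continuous f df :
  (forall x : R, is_derive x 1 f (df x)) -> continuous f.
Proof.
move=> fd x; have [+ _] := fd x.
by move=> /derivable1_diffP/differentiable_continuous.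
Qed.

Lemma is_derive_translate f df (c x : R) :
  (forall y : R, is_derive y 1 f (df y)) ->
  is_derive x 1 (fun y => f (y + c)) (df (x + c)).
Proof.
move=> fd; have fd_c := @is_derive1_comp R f (shift c) x _ _ (fd _) (is_derive_shift x 1 c).
by apply: (is_derive_eq fd_c); rewrite mulr1.
Qed.

Lemma is_derive_dilate f df (k x : R) :
  (forall y : R, is_derive y 1 f (df y)) ->
  is_derive x 1 (fun y => f (y * k)) (k * df (x * k)).
Proof.
move=> fd; have dilation : is_derive x 1 (fun y : R => y * k) k.
  by apply: is_derive_eq; rewrite scaler0 add0r /GRing.scale/= mulr1.
have fd_k := @is_derive1_comp R f (fun y => y * k) x _ _ (fd _) dilation.
by apply: (is_derive_eq fd_k); rewrite mulrC.
Qed.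

Lemma derive1_is_derive f df :
  (forall x : R, is_derive x 1 f (df x)) -> derive1 f = df.
Proof. by move=> fd; apply/funext => x; rewrite derive1E; have [_ ->] := fd x. Qed.

Lemma derivable_is_derive1 f (x : R) :
  derivable f x 1 -> is_derive x 1 f (derive1 f x).
Proof. by rewrite derive1E => /derivableP. Qed.

Lemma MVT_increment f df (x y : R) :
  (forall z : R, is_derive z 1 f (df z)) ->
  exists2 z, `|z - x| <= `|y - x| & f y - f x = df z * (y - x).
Proof.
move=> fd; have cf := is_derive_continuous fd.
have [xy|/ltW yx] := leP x y.
  have [|z] := @MVT_segment _ f df x y xy (fun z _ => fd z).
    exact: continuous_subspaceT.
  rewrite in_itv/= => /andP[xz zy] e; exists z => //.
  by rewrite !ger0_norm ?subr_ge0// lerD2r.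
have [|z] := @MVT_segment _ f df y x yx (fun z _ => fd z).
  exact: continuous_subspaceT.
rewrite in_itv/= => /andP[yz zx] e; exists z.
  by rewrite !ler0_norm ?subr_le0// !opprB lerD2l lerN2.
by rewrite -[LHS]opprB e -mulrN opprB.
Qed.

Lemma is_derive_klipschitz (C : R) f df :
  (forall x : R, is_derive x 1 f (df x)) -> (forall x, `|df x| <= C) ->
  C.-lipschitz f.
Proof.
move=> fd dfC; apply/klipschitzP => x y; have [z _ ->] := MVT_increment y x fd.
by rewrite normrM ler_wpM2r.
Qed.

Lemma taylor2_klipschitz (C : R) f df ddf (x t : R) :
  (forall y : R, is_derive y 1 f (df y)) ->
  (forall y : R, is_derive y 1 df (ddf y)) -> C.-lipschitz ddf -> 0 <= C ->
  `|f (x + t) - f x - t * df x - t ^+ 2 / 2 * ddf x| <= C * `|t| ^+ 3.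
Proof.
move=> fd dfd /klipschitzP ddfC C0.
pose r u := f (u + x) - f x - u * df x - u ^+ 2 / 2 * ddf x.
pose dr u := df (u + x) - df x - u * ddf x.
have rd (u : R) : is_derive u 1 r (dr u).
  have fdx := is_derive_translate x u fd.
  by apply: is_derive_eq; rewrite /dr /GRing.scale/=; field.
have drd (u : R) : is_derive u 1 dr (ddf (u + x) - ddf x).
  have dfdx := is_derive_translate x u dfd.
  by apply: is_derive_eq; rewrite /GRing.scale/=; ring.
have r0 : r 0 = 0 by rewrite /r add0r subrr expr0n/= !mul0r !subr0.
have dr0 : dr 0 = 0 by rewrite /dr add0r subrr mul0r subr0.
have [u ut] := MVT_increment 0 t rd; rewrite r0 !subr0 in ut * => rt.
have [v vu] := MVT_increment 0 u drd; rewrite dr0 !subr0 in vu * => dru.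
rewrite (addrC x) -/(r t) rt dru !normrM exprS expr2 !mulrA ler_wpM2r// ler_pM//.
apply: le_trans (ddfC _ _) _; rewrite addrK ler_wpM2l//.
exact: le_trans vu ut.
Qed.

End derivatives.

Section central_difference.
Context {R : realType}.
Implicit Types f df : R -> R.

Definition central_diff (e : R) f (x : R) : R := f (x - e) - f (x + e).

Lemma is_derive_central_diff e f df (x : R) :
  (forall y : R, is_derive y 1 f (df y)) ->
  is_derive x 1 (central_diff e f) (central_diff e df x).
Proof.
move=> fd.
exact: is_deriveB (is_derive_translate (- e) x fd) (is_derive_translate e x fd).
Qed.

Lemma klipschitz_central_diff C e f :
  C.-lipschitz f -> (C + C).-lipschitz (central_diff e f).
Proof.
move=> fC; exact: klipschitzB (klipschitz_translate (- e) fC)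
  (klipschitz_translate e fC).
Qed.

Lemma central_diff_le C e f x :
  0 <= e -> C.-lipschitz f -> `|central_diff e f x| <= C * (2 * e).
Proof.
move=> e0 /klipschitzP fC; apply: le_trans (fC _ _) _.
have -> : x - e - (x + e) = - (2 * e) by ring.
by rewrite normrN ger0_norm// mulr_ge0.
Qed.

Lemma central_diff_bounded M e f x :
  (forall y, `|f y| <= M) -> `|central_diff e f x| <= M + M.
Proof. by move=> fM; rewrite (le_trans (ler_normB _ _))// lerD. Qed.

Lemma nonincreasing_central_diff e f x y :
  {homo f : u v /~ u <= v} -> `|x - y| <= e ->
  `|f x - f y| <= central_diff e f y.
Proof.
rewrite /central_diff => f_ni; rewrite ler_norml => /andP[exy xye].
have fx_lo : f (y + e) <= f x by apply: f_ni; lra.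
have fx_hi : f x <= f (y - e) by apply: f_ni; lra.
have fy_lo : f (y + e) <= f y by apply: f_ni; lra.
have fy_hi : f y <= f (y - e) by apply: f_ni; lra.
by rewrite ler_norml; lra.
Qed.

End central_difference.

(** * Integrals against a probability *)

Section probability_integrals.
Context d (T : measurableType d) (R : realType) (P : probability T R).
Implicit Types (f g Z : T -> R) (M C : R).

Lemma integrable_bounded f M : measurable_fun [set: T] f ->
  (forall w, `|f w| <= M) -> P.-integrable [set: T] (EFin \o f).
Proof.
move=> mf fM; apply: measurable_bounded_integrable => //.
  by rewrite (le_lt_trans (probability_le1 _ _))// ltry.
exists M; split; first exact: num_real.
by move=> x Mx w _ /=; rewrite (le_trans (fM w))// ltW.
Qed.

Lemma Rintegral_cst_probability M : \int[P]_w M = M.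
Proof. by rewrite Rintegral_cst//= probability_setT mulr1. Qed.

Lemma ler_norm_Rintegral f g : P.-integrable [set: T] (EFin \o f) ->
  P.-integrable [set: T] (EFin \o g) -> (forall w, `|f w| <= g w) ->
  `|\int[P]_w f w| <= \int[P]_w g w.
Proof.
move=> intf intg fg; apply: le_trans (le_normr_Rintegral _ intf) _ => //.
by apply: le_Rintegral => //; exact: integrable_abse intf.
Qed.

Lemma normr_Rintegral_bounded f M : measurable_fun [set: T] f ->
  (forall w, `|f w| <= M) -> `|\int[P]_w f w| <= M.
Proof.
move=> mf fM; rewrite -[leRHS]Rintegral_cst_probability.
apply: ler_norm_Rintegral => //; first exact: integrable_bounded fM.
exact: finite_measure_integrable_cst.
Qed.

Lemma expectation_Rintegral f : P.-integrable [set: T] (EFin \o f) ->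
  'E_P[f] = (\int[P]_w f w)%:E.
Proof.
by move=> intf; rewrite unlock /Rintegral fineK//; exact: integrable_fin_num intf.
Qed.

Lemma ge0_integrable_expectation f : measurable_fun [set: T] f ->
  (forall w, 0 <= f w) -> ('E_P[f] < +oo)%E ->
  P.-integrable [set: T] (EFin \o f).
Proof.
move=> mf f0; rewrite unlock => Ef; apply/integrableP; split.
  exact/measurable_EFinP.
by under eq_integral do rewrite /= ger0_norm//.
Qed.

Lemma expectation_scale_sqr Z k : measurable_fun [set: T] Z ->
  'E_P[fun w => (k \o* Z) w ^+ 2] = ((k ^+ 2)%:E * 'E_P[fun w => (Z w ^+ 2)%R])%E.
Proof.
move=> mZ; rewrite unlock -ge0_integralZl//.
- by apply: eq_integral => w _; rewrite /= exprMn mulrC EFinM.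
- by apply/measurable_EFinP; exact: measurable_funX.
- by move=> w _; rewrite lee_fin sqr_ge0.
- by rewrite lee_fin sqr_ge0.
Qed.

Lemma integrable_add_cst Z M : P.-integrable [set: T] (EFin \o Z) ->
  P.-integrable [set: T] (EFin \o (fun w => M + Z w)).
Proof. exact: (integrableD measurableT (finite_measure_integrable_cst P M measurableT)). Qed.

Lemma klipschitz_integrable C (g : R -> R) Z : C.-lipschitz g ->
  P.-integrable [set: T] (EFin \o Z) ->
  P.-integrable [set: T] (EFin \o (g \o Z)).
Proof.
move=> gC intZ.
have intCZ := integrableZl measurableT C (integrable_abse intZ).
apply: le_integrable (integrable_add_cst `|g 0| intCZ) => //.
  apply/measurable_EFinP; apply: measurableT_comp.
    exact: klipschitz_measurable gC.
  by apply/measurable_EFinP; exact: measurable_int intZ.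
move=> w _ /=; rewrite lee_fin (le_trans (klipschitz_linear_growth _ gC))//.
exact: ler_norm.
Qed.

Lemma integrable_of_sqr Z : measurable_fun [set: T] Z ->
  P.-integrable [set: T] (EFin \o (fun w => Z w ^+ 2)) ->
  P.-integrable [set: T] (EFin \o Z).
Proof.
move=> mZ intZ2; apply: le_integrable (integrable_add_cst 1 intZ2) => //.
  exact/measurable_EFinP.
move=> w _ /=; rewrite lee_fin (le_trans _ (ler_norm _))//.
by rewrite -[Z w ^+ 2]real_normK ?num_real//; nra.
Qed.

(* AM-GM: [2 |z| <= s + z^2 / s]. *)
Lemma Rintegral_norm_le_sqrt Z s : 0 < s -> measurable_fun [set: T] Z ->
  P.-integrable [set: T] (EFin \o (fun w => Z w ^+ 2)) ->
  \int[P]_w (Z w ^+ 2) <= s ^+ 2 -> \int[P]_w `|Z w| <= s.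
Proof.
move=> s0 mZ intZ2 Z2s.
have amgm z : `|z| <= 2^-1 * s + (2 * s)^-1 * z ^+ 2.
  have <- : (2 * s)^-1 * (s - `|z|) ^+ 2 + `|z| = 2^-1 * s + (2 * s)^-1 * z ^+ 2.
    by rewrite -[z ^+ 2]real_normK ?num_real//; field; rewrite gt_eqF.
  by rewrite lerDr mulr_ge0 ?sqr_ge0// invr_ge0 mulr_ge0// ltW.
have intZ2s := integrableZl measurableT (2 * s)^-1 intZ2.
apply: (@le_trans _ _ (\int[P]_w (2^-1 * s + (2 * s)^-1 * Z w ^+ 2))).
  apply: le_Rintegral => //; last exact: integrable_add_cst intZ2s.
  exact: integrable_abse (integrable_of_sqr mZ intZ2).
rewrite RintegralD//; last exact: finite_measure_integrable_cst.
rewrite Rintegral_cst_probability RintegralZl//.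
have : (2 * s)^-1 * \int[P]_w (Z w ^+ 2) <= (2 * s)^-1 * s ^+ 2.
  by rewrite ler_wpM2l// invr_ge0 mulr_ge0// ltW.
have -> : (2 * s)^-1 * s ^+ 2 = 2^-1 * s by field; rewrite gt_eqF.
lra.
Qed.

End probability_integrals.

(** * Geometric means *)

Section geometric_mean.
Context {R : realType}.
Variable p : R.
Implicit Types (a c : nat -> R) (l m : R).

Definition is_geometric_mean a l : Prop :=
  (\sum_(j < n) p * (1 - p) ^+ j * a j) @[n --> \oo] --> l.

Lemma is_geometric_mean_unique a l m :
  is_geometric_mean a l -> is_geometric_mean a m -> l = m.
Proof. exact: cvg_unique. Qed.

Lemma is_geometric_meanD a c l m : is_geometric_mean a l ->
  is_geometric_mean c m -> is_geometric_mean (fun j => a j + c j) (l + m).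
Proof.
move=> al cm; rewrite /is_geometric_mean.
by under eq_fun do [under eq_bigr do rewrite mulrDr; rewrite big_split/=]; exact: cvgD.
Qed.

Lemma is_geometric_meanZl k a l : is_geometric_mean a l ->
  is_geometric_mean (fun j => k * a j) (k * l).
Proof.
move=> al; rewrite /is_geometric_mean.
under eq_fun do [under eq_bigr do rewrite mulrCA; rewrite -mulr_sumr].
by apply: cvgM al; exact: cvg_cst.
Qed.

Lemma is_geometric_meanB a c l m : is_geometric_mean a l ->
  is_geometric_mean c m -> is_geometric_mean (fun j => a j - c j) (l - m).
Proof.
move=> al cm; rewrite /is_geometric_mean.
by under eq_fun do [under eq_bigr do rewrite mulrBr; rewrite sumrB]; exact: cvgB.
Qed.

Lemma is_geometric_mean_series (u a : nat -> R) l :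
  (forall j, u j.+1 = p * (1 - p) ^+ j * a j) ->
  (\sum_(0 <= k < n) u k) @[n --> \oo] --> l -> is_geometric_mean a (l - u 0%N).
Proof.
rewrite -[X in _ -> X -> _]cvg_shiftS => ua ul.
rewrite /is_geometric_mean; under eq_fun => n.
  under eq_bigr do rewrite -ua.
  have -> : \sum_(j < n) u j.+1 = \sum_(0 <= k < n.+1) u k - u 0%N.
    by rewrite big_nat_recl//= big_mkord addrC addKr.
  over.
by apply: cvgB ul _; exact: cvg_cst.
Qed.

(* Memorylessness: a geometric index minus one is [0] with probability [p],
   and otherwise distributed as the index itself. *)
Lemma is_geometric_mean_shift a l : is_geometric_mean (fun j => a j.+1) l ->
  is_geometric_mean a (p * a 0%N + (1 - p) * l).
Proof.
rewrite /is_geometric_mean -[X in _ -> X]cvg_shiftS => al.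
under eq_fun => n.
  rewrite big_ord_recl/= expr0 mulr1.
  under eq_bigr => j _.
    have -> : p * (1 - p) ^+ bump 0 j * a (bump 0 j) =
        (1 - p) * (p * (1 - p) ^+ j * a j.+1) by rewrite /bump/= add1n exprS; ring.
    over.
  rewrite -mulr_sumr.
  over.
by apply: cvgD; [exact: cvg_cst|apply: cvgM al; exact: cvg_cst].
Qed.

Hypothesis p01 : 0 < p < 1.

Let p_gt0 : 0 < p. Proof. by case/andP: p01. Qed.
Let q_gt0 : 0 < 1 - p. Proof. by rewrite subr_gt0; case/andP: p01. Qed.

Lemma sum_geometricM_le n : \sum_(j < n) p * (1 - p) ^+ j * j.+1%:R <= p^-1.
Proof.
have -> : \sum_(j < n) p * (1 - p) ^+ j * j.+1%:R =
    p^-1 - (p^-1 * (1 - p) ^+ n + n%:R * (1 - p) ^+ n).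
  elim: n => [|n IHn]; first by rewrite big_ord0 expr0; ring.
  by rewrite big_ord_recr/= IHn exprS -natr1; field; rewrite gt_eqF.
by rewrite gerBl addr_ge0// mulr_ge0 ?exprn_ge0 ?invr_ge0// ltW.
Qed.

Lemma is_geometric_mean_cst l : is_geometric_mean (cst l) l.
Proof.
rewrite /is_geometric_mean; under eq_fun do rewrite -mulr_suml.
suff : \sum_(j < n) p * (1 - p) ^+ j @[n --> \oo] --> (1 : R).
  by move=> sum1; rewrite -[l in nbhs l]mul1r; apply: cvgM sum1 _; exact: cvg_cst.
have q_lt1 : `|1 - p| < 1 by rewrite ger0_norm ?ltW// gtrBl.
have := cvg_geometric_series (a := p) q_lt1; rewrite subKr mulfV ?gt_eqF//.
by rewrite /series/=; under eq_fun do rewrite big_mkord.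
Qed.

Lemma ler_norm_geometric_mean a c l m : is_geometric_mean a l ->
  is_geometric_mean c m -> (forall j, `|a j| <= c j) -> `|l| <= m.
Proof.
move=> al cm ac; apply: (ler_cvg_to (cvg_norm al) cm); apply: nearW => n.
apply: le_trans (ler_norm_sum _ _ _) _; apply: ler_sum => j _.
have w0 : 0 <= p * (1 - p) ^+ j by rewrite mulr_ge0 ?exprn_ge0// ltW.
by rewrite normrM ger0_norm// ler_wpM2l.
Qed.

End geometric_mean.

(** * The Stein equation of the Laplace distribution *)

Section integrals_on_half_lines.
Context {R : realType}.
Notation mu := (@lebesgue_measure R).

Lemma ge0_continuous_FTC2Ny (f F : R -> R) (x l : R) :
  (forall t, t <= x -> 0 <= f t) -> continuous f ->
  (forall t : R, is_derive t 1 F (f t)) -> F (- t) @[t --> +oo] --> l ->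
  (\int[mu]_(t in `]-oo, x]) (f t)%:E = (F x - l)%:E)%E.
Proof.
move=> f0 cf dF Fl.
transitivity (\int[mu]_(t in `]-oo, (- - x)%R]) (f t)%:E)%E; first by rewrite opprK.
rewrite ge0_integration_by_substitutionNy; last 2 first.
- exact: continuous_subspaceT.
- by move=> t /[!in_itv]/= tx; rewrite f0// -(opprK x) ltW.
have dFN (t : R) : is_derive t 1 (fun u => - F (- u)) (f (- t)).
  have := is_deriveN (@is_derive1_comp R F -%R t _ _ (dF _) (is_deriveN (is_derive_id t 1))).
  by move=> dFN; apply: (is_derive_eq dFN); rewrite mulrN1 opprK.
rewrite (@ge0_continuous_FTC2y _ _ (fun u => - F (- u)) (- x) (- l)).
- by rewrite opprK -EFinB opprK addrC.
- by move=> t xt; apply: f0; rewrite lerNl.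
- apply: continuous_subspaceT => t.
  by apply: (continuous_comp (f := -%R) (g := f)); [exact: opp_continuous|exact: cf].
- exact: cvgN.
- by move=> t _; have [] := dFN t.
- by apply: cvg_at_right_filter; exact: is_derive_continuous dFN (- x).
- by move=> t _; rewrite derive1E; have [_ ->] := dFN t.
Qed.

Lemma integral_itvcy_oppr (f : R -> \bar R) : measurable_fun [set: R] f ->
  (\int[mu]_(r in `[0%R, +oo[) f r = \int[mu]_(r in `]-oo, 0%R]) f (- r)%R)%E.
Proof.
move=> mf; rewrite integralE [RHS]integralE; congr (_ - _)%E.
- rewrite ge0_integration_by_substitution0//; last exact: measurable_funepos.
  by apply: eq_integral => r _; rewrite !funeposE.
- rewrite ge0_integration_by_substitution0//; last exact: measurable_funeneg.
  by apply: eq_integral => r _; rewrite !funenegE.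
Qed.

(* [|c + d u| <= (|c| + |d|) (1 + u) <= 2 (|c| + |d|) e^(u / 2)]. *)
Lemma cvg_expRN_affine (c d : R) :
  expR (- u) * (c + d * u) @[u --> +oo] --> (0 : R).
Proof.
pose M := 2 * (`|c| + `|d|).
have M0 : 0 <= M by rewrite mulr_ge0 ?addr_ge0.
apply/norm_cvg0P.
apply: (@squeeze_cvgr _ _ _ _ (cst 0) (fun u => M * expR (- (u * 2^-1)))).
- near=> u.
  have u0 : 0 <= u by near: u; apply: nbhs_pinfty_ge; rewrite num_real.
  rewrite normr_ge0/= normrM (ger0_norm (expR_ge0 _)).
  have affine_le : `|c + d * u| <= M * expR (u * 2^-1).
    apply: (@le_trans _ _ (M * (1 + u * 2^-1))); last first.
      by rewrite ler_wpM2l// expR_ge1Dx.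
    apply: le_trans (ler_normD _ _) _; rewrite normrM (ger0_norm u0).
    have := mulr_ge0 (normr_ge0 c) u0; rewrite /M.
    by have := normr_ge0 c; have := normr_ge0 d; lra.
  apply: le_trans (ler_wpM2l (expR_ge0 _) affine_le) _.
  rewrite mulrCA -expRD (_ : - u + u * 2^-1 = - (u * 2^-1))//; lra.
- exact: cvg_cst.
- rewrite -[X in _ --> X](mulr0 M); apply: cvgM; first exact: cvg_cst.
  apply: (cvg_comp (fun u : R => u * 2^-1) (fun v : R => expR (- v))).
    by apply: gt0_cvgMly; [rewrite invr_gt0|exact: cvg_id].
  exact: cvgr_expR.
Unshelve. all: by end_near. Qed.

End integrals_on_half_lines.

Section stein_equation.
Context {R : realType}.
Variable b : R.
Hypothesis b_gt0 : 0 < b.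
Notation mu := (@lebesgue_measure R).
Implicit Types (h g : R -> R) (C D x c d : R).

Let b_neq0 : b != 0. Proof. by rewrite gt_eqF. Qed.
Let b_ge0 : 0 <= b. Proof. exact: ltW. Qed.

Lemma continuous_expRM h : continuous h ->
  continuous (fun t : R => expR (t / b) * h t).
Proof.
move=> ch t; apply: cvgM; last exact: ch.
apply: continuous_comp; last exact: continuous_expR.
by apply: cvgM => //; exact: cvg_cst.
Qed.

Lemma measurable_expRM C h (A : set (measurableTypeR R)) :
  C.-lipschitz h -> measurable A ->
  measurable_fun A (fun t : R => expR (t / b) * h t).
Proof.
move=> hC mA; apply/measurable_funTS.
by apply: continuous_measurable_fun; exact: continuous_expRM (klipschitz_continuous hC).
Qed.

Lemma klipschitz_affine x c d : `|d|.-lipschitz (fun t : R => c + d * (x - t)).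
Proof.
apply/klipschitzP => s t.
have -> : c + d * (x - s) - (c + d * (x - t)) = - (d * (s - t)) by ring.
by rewrite normrN normrM.
Qed.

Lemma integral_expR_affine x c d : 0 <= c -> 0 <= d ->
  (\int[mu]_(t in `]-oo, x]) (expR (t / b) * (c + d * (x - t)))%:E =
   (expR (x / b) * (b * c + b ^+ 2 * d))%:E)%E.
Proof.
move=> c0 d0.
pose F t := expR (t / b) * (b * c + b ^+ 2 * d + b * d * (x - t)).
have dF (t : R) : is_derive t 1 F (expR (t / b) * (c + d * (x - t))).
  by rewrite /F; apply: is_derive_eq; rewrite /GRing.scale/=; field.
rewrite (@ge0_continuous_FTC2Ny _ _ F x 0 _ _ dF).
- by rewrite /F subrr mulr0 addr0 subr0.
- by move=> t tx; rewrite mulr_ge0 ?expR_ge0 ?addr_ge0 ?mulr_ge0 ?subr_ge0.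
- exact: continuous_expRM (klipschitz_continuous (klipschitz_affine x c d)).
pose A := b * c + b ^+ 2 * d + b * d * x.
rewrite (_ : (fun t => F (- t)) =
    (fun u => expR (- u) * (A + b ^+ 2 * d * u)) \o (fun t => t / b)).
  apply: cvg_comp; last exact: cvg_expRN_affine.
  by apply: gt0_cvgMly; [rewrite invr_gt0|exact: cvg_id].
by apply/funext => t; rewrite /F /A/= mulNr opprK; congr (_ * _); field.
Qed.

Lemma integrable_expR_affine x c d : 0 <= c -> 0 <= d ->
  mu.-integrable `]-oo, x] (EFin \o (fun t => expR (t / b) * (c + d * (x - t)))).
Proof.
move=> c0 d0; apply/integrableP; split.
  by apply/measurable_EFinP; exact: measurable_expRM (klipschitz_affine x c d) _.
rewrite [ltLHS](_ : _ = (expR (x / b) * (b * c + b ^+ 2 * d))%:E) ?ltry//.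
rewrite -integral_expR_affine//; apply: eq_integral => t; rewrite inE/= in_itv/= => tx.
by rewrite ger0_norm// mulr_ge0 ?expR_ge0 ?addr_ge0 ?mulr_ge0 ?subr_ge0.
Qed.

Lemma integrable_expRM C h x : 0 <= C -> C.-lipschitz h ->
  mu.-integrable `]-oo, x] (EFin \o (fun t => expR (t / b) * h t)).
Proof.
move=> C0 hC; apply: le_integrable (integrable_expR_affine x (normr_ge0 (h x)) C0) => //.
  by apply/measurable_EFinP; exact: measurable_expRM hC _.
move=> t; rewrite /= in_itv/= => tx; rewrite lee_fin !normrM ler_wpM2l//.
rewrite [leRHS]ger0_norm ?addr_ge0 ?mulr_ge0 ?subr_ge0//.
have /klipschitzP/(_ t x) := hC; rewrite [`|t - x|]ler0_norm ?subr_le0// opprB => htx.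
by rewrite -[h t](subrK (h x)) (le_trans (ler_normD _ _))//; lra.
Qed.

(* Half of [E h(x - b Y)] for a standard exponential variable [Y]. *)
Definition half_resolvent h x : R :=
  (2 * b)^-1 * (expR (- (x / b)) * \int[mu]_(t in `]-oo, x]) (expR (t / b) * h t)).

Lemma is_derive_half_resolvent C h x : 0 <= C -> C.-lipschitz h ->
  is_derive x 1 (half_resolvent h) (h x / (2 * b) - half_resolvent h x / b).
Proof.
move=> C0 hC.
pose F y := \int[mu]_(t in `]-oo, y]) (expR (t / b) * h t).
have dF : is_derive x 1 F (expR (x / b) * h x).
  have [||||dF F'] := @continuous_FTC1 R (fun t => expR (t / b) * h t) -oo%O x (x + 1).
  - by rewrite ltrDl.
  - exact: integrable_expRM C0 hC.
  - by rewrite ltNyr.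
  - by apply: continuous_expRM; exact: klipschitz_continuous hC.
  by apply: DeriveDef; [exact: dF|rewrite -derive1E; exact: F'].
rewrite /half_resolvent -/(F _).
have -> : (fun y => (2 * b)^-1 * (expR (- (y / b)) * F y)) =
    (fun y => (2 * b)^-1 * expR (- (y / b))) * F by apply/funext => y /=; rewrite mulrA.
apply: is_derive_eq; rewrite scaler0 add0r /GRing.scale/= mulr1 expRN.
by field; rewrite b_neq0 gt_eqF ?expR_gt0.
Qed.

Lemma half_resolvent_mono C D h g x :
  0 <= C -> C.-lipschitz h -> 0 <= D -> D.-lipschitz g ->
  (forall t, t <= x -> h t <= g t) -> half_resolvent h x <= half_resolvent g x.
Proof.
move=> C0 hC D0 gD hg; rewrite ler_pM2l ?invr_gt0 ?mulr_gt0//.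
rewrite ler_pM2l ?expR_gt0//; apply: le_Rintegral => //.
- exact: integrable_expRM C0 hC.
- exact: integrable_expRM D0 gD.
- by move=> t; rewrite /= in_itv/= => tx; rewrite ler_pM2l ?expR_gt0// hg.
Qed.

Lemma half_resolvent_affine x c d :
  half_resolvent (fun t => c + d * (x - t)) x = 2^-1 * (c + b * d).
Proof.
have int_cst := integrable_expR_affine x ler01 (lexx 0).
have int_lin := integrable_expR_affine x (lexx 0) ler01.
have Rint (c' d' : R) : 0 <= c' -> 0 <= d' ->
    \int[mu]_(t in `]-oo, x]) (expR (t / b) * (c' + d' * (x - t))) =
    expR (x / b) * (b * c' + b ^+ 2 * d').
  by move=> c0 d0; rewrite /Rintegral integral_expR_affine.
have -> : half_resolvent (fun t => c + d * (x - t)) x =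
    (2 * b)^-1 * (expR (- (x / b)) *
      (c * (expR (x / b) * (b * 1 + b ^+ 2 * 0)) +
       d * (expR (x / b) * (b * 0 + b ^+ 2 * 1)))).
  rewrite -!Rint// -!RintegralZl// -RintegralD//; last 2 first.
  - exact: (integrableZl _ c int_cst).
  - exact: (integrableZl _ d int_lin).
  by congr (_ * (_ * _)); apply: eq_Rintegral => t _ /=; ring.
by rewrite expRN; field; rewrite b_neq0 gt_eqF ?expR_gt0.
Qed.

Lemma half_resolvent_lipschitz h x : 1.-lipschitz h ->
  `|half_resolvent h x - 2^-1 * h x| <= 2^-1 * b.
Proof.
move=> h1.
have h_cone t : t <= x -> h x + (- 1) * (x - t) <= h t <= h x + 1 * (x - t).
  move=> tx; have /klipschitzP/(_ t x) := h1; rewrite mul1r [`|t - x|]ler0_norm ?subr_le0//.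
  by rewrite ler_norml; lra.
have lower : half_resolvent (fun t => h x + (- 1) * (x - t)) x <= half_resolvent h x.
  apply: (half_resolvent_mono _ (klipschitz_affine x (h x) (-1)) _ h1) => // t tx.
  by case/andP: (h_cone _ tx).
have upper : half_resolvent h x <= half_resolvent (fun t => h x + 1 * (x - t)) x.
  apply: (half_resolvent_mono _ h1 _ (klipschitz_affine x (h x) 1)) => // t tx.
  by case/andP: (h_cone _ tx).
by move: lower upper; rewrite !half_resolvent_affine ler_norml; lra.
Qed.

Lemma half_resolvent_itv01 C h x : 0 <= C -> C.-lipschitz h ->
  (forall t, 0 <= h t <= 1) -> 0 <= half_resolvent h x <= 2^-1.
Proof.
move=> C0 hC h01.
have lower : half_resolvent (fun t => 0 + 0 * (x - t)) x <= half_resolvent h x.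
  apply: (half_resolvent_mono _ (klipschitz_affine x 0 0) _ hC) => // t _.
  by rewrite mul0r addr0; case/andP: (h01 t).
have upper : half_resolvent h x <= half_resolvent (fun t => 1 + 0 * (x - t)) x.
  apply: (half_resolvent_mono _ hC _ (klipschitz_affine x 1 0)) => // t _.
  by rewrite mul0r addr0; case/andP: (h01 t).
by move: lower upper; rewrite !half_resolvent_affine; lra.
Qed.

Definition stein_sol h x : R :=
  half_resolvent h x + half_resolvent (h \o -%R) (- x).

Definition stein_sol' h x : R :=
  (half_resolvent (h \o -%R) (- x) - half_resolvent h x) / b.

Definition stein_sol'' h x : R := (stein_sol h x - h x) / b ^+ 2.

Lemma stein_sol''E h x : b ^+ 2 * stein_sol'' h x = stein_sol h x - h x.
Proof. by rewrite /stein_sol'' mulrC divfK// expf_neq0. Qed.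

Section lipschitz_stein_sol.
Variables (C : R) (h : R -> R).
Hypotheses (C_ge0 : 0 <= C) (h_lip : C.-lipschitz h).

Let is_derive_half_resolvent_oppr x :
  is_derive x 1 (fun y => half_resolvent (h \o -%R) (- y))
    (half_resolvent (h \o -%R) (- x) / b - h x / (2 * b)).
Proof.
have dh := is_derive_half_resolvent (- x) C_ge0 (klipschitz_reflect h_lip).
have dhN := is_derive1_comp dh (is_deriveN (is_derive_id x (1 : R))).
by apply: (is_derive_eq dhN); rewrite /= opprK; ring.
Qed.

Lemma is_derive_stein_sol x : is_derive x 1 (stein_sol h) (stein_sol' h x).
Proof.
have df := is_deriveD (is_derive_half_resolvent x C_ge0 h_lip)
  (is_derive_half_resolvent_oppr x).
by apply: (is_derive_eq df); rewrite /stein_sol'; ring.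
Qed.

Lemma is_derive_stein_sol' x : is_derive x 1 (stein_sol' h) (stein_sol'' h x).
Proof.
have df := is_deriveM (is_deriveB (is_derive_half_resolvent_oppr x)
  (is_derive_half_resolvent x C_ge0 h_lip)) (is_derive_cst (b^-1) x 1).
by apply: (is_derive_eq df); rewrite /stein_sol'' /stein_sol /GRing.scale/=; field.
Qed.

Lemma stein_sol_itv01 x : (forall t, 0 <= h t <= 1) -> 0 <= stein_sol h x <= 1.
Proof.
move=> h01; have := half_resolvent_itv01 x C_ge0 h_lip h01.
have := half_resolvent_itv01 (- x) C_ge0 (klipschitz_reflect h_lip) (fun t => h01 (- t)).
by rewrite /stein_sol; lra.
Qed.

Lemma stein_sol'_bounded x :
  (forall t, 0 <= h t <= 1) -> `|stein_sol' h x| <= (2 * b)^-1.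
Proof.
move=> h01; have := half_resolvent_itv01 x C_ge0 h_lip h01.
have := half_resolvent_itv01 (- x) C_ge0 (klipschitz_reflect h_lip) (fun t => h01 (- t)).
rewrite normrM [`|b^-1|]ger0_norm ?invr_ge0// invfM ler_pM2r ?invr_gt0//.
by rewrite ler_norml; lra.
Qed.

Lemma klipschitz_stein_sol_itv01 :
  (forall t, 0 <= h t <= 1) -> (2 * b)^-1.-lipschitz (stein_sol h).
Proof.
move=> h01; apply: is_derive_klipschitz is_derive_stein_sol _ => x.
exact: stein_sol'_bounded.
Qed.

Lemma klipschitz_stein_sol'' D : D.-lipschitz (stein_sol h) ->
  ((b ^+ 2)^-1 * (D + C)).-lipschitz (stein_sol'' h).
Proof.
move=> fD; have := klipschitzZl (b ^+ 2)^-1 (klipschitzB fD h_lip).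
rewrite ger0_norm ?invr_ge0 ?sqr_ge0//.
by congr (_.-lipschitz _); apply/funext => x; rewrite mulrC.
Qed.

Lemma stein_sol''_bounded x :
  (forall t, 0 <= h t <= 1) -> `|stein_sol'' h x| <= (b ^+ 2)^-1.
Proof.
move=> h01; rewrite normrM [`|(b ^+ 2)^-1|]ger0_norm ?invr_ge0 ?sqr_ge0//.
rewrite ler_piMl ?invr_ge0 ?sqr_ge0// ler_norml.
by have := stein_sol_itv01 x h01; have := h01 x; lra.
Qed.

End lipschitz_stein_sol.

Lemma klipschitz_stein_sol1 h : 1.-lipschitz h -> 1.-lipschitz (stein_sol h).
Proof.
move=> h1; apply: is_derive_klipschitz (is_derive_stein_sol ler01 h1) _ => x.
have := half_resolvent_lipschitz x h1.
have := half_resolvent_lipschitz (- x) (klipschitz_reflect h1); rewrite /= opprK.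
rewrite normrM [`|b^-1|]ger0_norm ?invr_ge0// ler_pdivrMr// mul1r.
by rewrite !ler_norml => /andP[? ?] /andP[? ?]; lra.
Qed.

Lemma laplace_pdf_ge0 x : 0 <= laplace_pdf b x.
Proof. by rewrite mulr_ge0 ?expR_ge0// invr_ge0 mulr_ge0. Qed.

Lemma laplace_pdf_le x : laplace_pdf b x <= (2 * b)^-1.
Proof.
by rewrite ler_piMr ?invr_ge0 ?mulr_ge0// -expR0 ler_expR oppr_le0 divr_ge0.
Qed.

Lemma laplace_pdfN x : laplace_pdf b (- x) = laplace_pdf b x.
Proof. by rewrite /laplace_pdf normrN. Qed.

Lemma measurable_laplace_pdf : measurable_fun [set: R] (laplace_pdf b).
Proof.
apply: measurable_funM => //; apply: measurableT_comp => //.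
by apply: measurableT_comp => //; exact: measurable_funM.
Qed.

Lemma integral_laplace_half_resolvent C h : 0 <= C -> C.-lipschitz h ->
  (\int[mu]_(y in `]-oo, 0%R]) (h y * laplace_pdf b y)%:E = (half_resolvent h 0)%:E)%E.
Proof.
move=> C0 hC; have int_h := integrable_expRM 0 C0 hC.
rewrite /half_resolvent mul0r oppr0 expR0 mul1r -RintegralZl// /Rintegral fineK.
  apply: eq_integral => y; rewrite inE/= in_itv/= => y0.
  by rewrite /laplace_pdf ler0_norm// mulNr opprK mulrC mulrA.
by apply: integrable_fin_num => //; exact: (integrableZl _ _ int_h).
Qed.

Lemma laplace_expect_stein_sol C h : 0 <= C -> C.-lipschitz h ->
  laplace_expect b h = (stein_sol h 0)%:E.
Proof.
move=> C0 hC; rewrite /laplace_expect.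
have mh : measurable_fun [set: R] (fun y => (h y * laplace_pdf b y)%:E).
  apply/measurable_EFinP/measurable_funM; last exact: measurable_laplace_pdf.
  exact: klipschitz_measurable hC.
have -> : [set: R] = `]-oo, 0%R] `|` `]0%R, +oo[.
  by apply/esym/seteqP; split => // y _ /=; rewrite !in_itv/= andbT; case: leP; [left|right].
rewrite integral_setU//; last 2 first.
- exact: measurable_funTS.
- apply/disj_setPS => y /=; rewrite !in_itv/= andbT => -[]; lra.
rewrite integral_itv_obnd_cbnd; last exact: measurable_funTS.
rewrite integral_itvcy_oppr// /stein_sol EFinD oppr0; congr (_ + _)%E.
  exact: integral_laplace_half_resolvent C0 hC.
rewrite -(integral_laplace_half_resolvent C0 (klipschitz_reflect hC)).
by apply: eq_integral => y _; rewrite laplace_pdfN.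
Qed.

End stein_equation.

(** * Independence *)

Section independent_pairs.
Context d (T : measurableType d) (R : realType) (P : probability T R).
Local Open Scope ereal_scope.

Definition rv_pair (S Z : {RV P >-> R}) (w : T) : R * R := (S w, Z w).

Lemma measurable_rv_pair S Z : measurable_fun [set: T] (rv_pair S Z).
Proof. exact: measurable_fun_pair. Qed.

HB.instance Definition _ S Z :=
  @isMeasurableFun.Build _ _ _ _ (rv_pair S Z) (measurable_rv_pair S Z).

Definition indep_pair (S Z : T -> R) : Prop :=
  forall A B, measurable A -> measurable B ->
  P (S @^-1` A `&` Z @^-1` B) = P (S @^-1` A) * P (Z @^-1` B).

(* Both sides are finite measures in [D] that agree on rectangles. *)
Lemma rv_pair_indep_event (S Z : {RV P >-> R}) (E : set T) (D : set (R * R)) :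
  measurable E -> measurable D ->
  (forall A B, measurable A -> measurable B ->
    P (S @^-1` A `&` Z @^-1` B `&` E) = P (S @^-1` A `&` Z @^-1` B) * P E) ->
  P (rv_pair S Z @^-1` D `&` E) = P (rv_pair S Z @^-1` D) * P E.
Proof.
move=> mE mD SZE; have PE_fin : P E \is a fin_num by rewrite fin_num_measure.
have PE_ge0 : (0 <= fine (P E))%R by rewrite fine_ge0.
pose restricted := pushforward (mrestr P mE) (rv_pair S Z).
pose scaled := mscale (NngNum PE_ge0) (distribution P (rv_pair S Z)).
have scaledE A : scaled A = P (rv_pair S Z @^-1` A) * P E.
  by rewrite muleC -[in RHS](fineK PE_fin).
rewrite -scaledE; change (restricted D = scaled D).
apply: (measure_unique [set A `*` B | A in measurable & B in measurable] (fun=> setT)).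
- exact: measurable_prod_measurableType.
- move=> _ _ [A mA [B mB <-]] [A' mA' [B' mB' <-]].
  exists (A `&` A'); first exact: measurableI.
  by exists (B `&` B'); [exact: measurableI|rewrite setXI].
- by move=> _; exists setT => //; exists setT => //; rewrite setXTT.
- by rewrite bigcup_const//; exists 0%N.
- by move=> _ [A mA [B mB <-]]; exact: etrans (SZE A B mA mB) (esym (scaledE _)).
- move=> _; rewrite (le_lt_trans (probability_le1 _ _)) ?ltry//.
  by rewrite preimage_setT setTI.
- exact: mD.
Qed.

End independent_pairs.

Section indep_pair_integrals.
Context d (T : measurableType d) (R : realType) (P : probability T R).
Variables (S Z : {RV P >-> R}).
Hypothesis SZ : indep_pair P S Z.

Let product_law (D : set (R * R)) : measurable D ->
  (distribution P S \x distribution P Z)%E D = distribution P (rv_pair S Z) D.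
Proof. by move=> mD; apply: product_measure_unique => // A B; exact: SZ. Qed.

Section fubini.
Variable F : R * R -> R.
Hypothesis mF : measurable_fun [set: R * R] F.
Hypothesis int_joint : P.-integrable [set: T] (fun w => (F (S w, Z w))%:E).
Hypothesis int_section :
  forall s, P.-integrable [set: T] (fun v => (F (s, Z v))%:E).

Let mEF : measurable_fun [set: R * R] (EFin \o F).
Proof. exact/measurable_EFinP. Qed.

Let integral_product_law (G : R * R -> \bar R) :
  (\int[distribution P S \x distribution P Z]_z G z =
   \int[distribution P (rv_pair S Z)]_z G z)%E.
Proof. by apply: eq_measure_integral => A mA _; exact: product_law. Qed.

Let integrable_product :
  (distribution P S \x distribution P Z)%E.-integrable [set: R * R] (EFin \o F).
Proof.
apply/integrableP; split => //; rewrite integral_product_law.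
rewrite ge0_integral_distribution//; last exact: measurableT_comp.
by have /integrableP[] := int_joint.
Qed.

Let fubini_F_section : fubini_F (distribution P Z) (EFin \o F) =
  (fun s => (\int[P]_v F (s, Z v))%R%:E).
Proof.
apply/funext => s; rewrite /fubini_F integral_distribution//.
- by rewrite /Rintegral fineK//; exact: integrable_fin_num.
- exact: measurableT_comp.
- exact: int_section.
Qed.

Let integrable_sections :
  (distribution P S).-integrable [set: R] (fun s => (\int[P]_v F (s, Z v))%R%:E).
Proof. by rewrite -fubini_F_section; exact: integrable_fubini_F. Qed.

Lemma integrable_indep_pair :
  P.-integrable [set: T] (fun w => (\int[P]_v F (S w, Z v))%R%:E).
Proof.
have /integrableP[mG] := integrable_sections.
rewrite ge0_integral_distribution//; last exact: measurableT_comp.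
by move=> fin_G; apply/integrableP; split => //; exact: (measurableT_comp mG).
Qed.

Lemma Rintegral_indep_pair :
  (\int[P]_w F (S w, Z w) = \int[P]_w \int[P]_v F (S w, Z v))%R.
Proof.
rewrite /Rintegral; congr fine.
transitivity (\int[distribution P S \x distribution P Z]_z (EFin \o F) z)%E.
  by rewrite integral_product_law integral_distribution.
rewrite -integral12_prod_meas1// -/(fubini_F _ (EFin \o F)) fubini_F_section.
rewrite integral_distribution//; last exact: integrable_indep_pair.
exact: measurable_int integrable_sections.
Qed.

End fubini.

Lemma Rintegral_indep_event (g : R -> R) (B : set R) :
  measurable B -> measurable_fun [set: R] g ->
  P.-integrable [set: T] (EFin \o (g \o S)) ->
  \int[P]_(w in Z @^-1` B) g (S w) = fine (P (Z @^-1` B)) * \int[P]_w g (S w).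
Proof.
move=> mB mg int_g.
have mZB : measurable (Z @^-1` B) by exact: measurable_funPTI.
pose F (z : R * R) := g z.1 * \1_B z.2.
have mF : measurable_fun [set: R * R] F.
  apply: measurable_funM; first exact: measurableT_comp.
  by apply: measurableT_comp => //; exact: measurable_indic.
have int_restrict f : P.-integrable [set: T] (EFin \o f) ->
    P.-integrable [set: T] (fun w => (f w * \1_B (Z w))%:E).
  move=> int_f; apply: (le_integrable _ _ _ int_f) => //.
    apply/measurable_EFinP/measurable_funM; last first.
      by apply: measurableT_comp => //; exact: measurable_indic.
    by apply/measurable_EFinP; exact: measurable_int int_f.
  by move=> w _ /=; rewrite lee_fin normrM ler_piMr// indicE normr_nat; case: (_ \in _).
have -> : \int[P]_(w in Z @^-1` B) g (S w) = \int[P]_w F (S w, Z w).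
  rewrite Rintegral_mkcond; apply: eq_Rintegral => w _.
  rewrite patchE /F/= indicE [w \in _](_ : _ = (Z w \in B))//.
  by case: ifP; rewrite ?mulr1 ?mulr0.
rewrite (Rintegral_indep_pair mF); last 2 first.
- exact: int_restrict.
- by move=> s; apply: (int_restrict (cst (g s))); exact: finite_measure_integrable_cst.
rewrite -RintegralZl//; apply: eq_Rintegral => w _.
rewrite /F/= RintegralZl//; last first.
  exact: (integrable_indic _ mZB).
by rewrite mulrC /Rintegral integral_indic// setIT.
Qed.

End indep_pair_integrals.

Section independent_families.
Context d (T : measurableType d) (R : realType) (P : probability T R).
Variables (I : eqType) (Y : I -> {RV P >-> R}).
Hypothesis Y_indep : mutually_independent P (fun i => Y i : T -> R).
Implicit Types (J s : seq I) (A : set R) (B : I -> set R).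

Definition joint_event J B : set T :=
  \bigcap_(j in [set j | j \in J]) (Y j @^-1` B j).

Lemma measurable_joint_event J B :
  (forall j, j \in J -> measurable (B j)) -> measurable (joint_event J B).
Proof.
move=> mB; apply: fin_bigcap_measurable => [|j jJ]; first exact: finite_seq.
by apply: measurable_funPTI; exact: mB.
Qed.

Lemma joint_event1 i B : joint_event [:: i] B = Y i @^-1` B i.
Proof.
apply/seteqP; split => [w /(_ i)|w wB j]; first by apply; exact: mem_head.
by rewrite /= inE => /eqP ->.
Qed.

Lemma joint_event_cons i A J B : i \notin J ->
  joint_event (i :: J) [eta B with i |-> A] = Y i @^-1` A `&` joint_event J B.
Proof.
move=> iJ; apply/seteqP; split => w.
  move=> wB; split; first by have := wB i; rewrite /= eqxx; apply; exact: mem_head.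
  move=> j /= jJ; have := wB j; rewrite /= inE jJ orbT => /(_ isT).
  by case: eqP => // ji; rewrite ji (negbTE iJ) in jJ.
move=> [wA wB] j /=; rewrite inE; case: eqVneq => [-> //|_ /=]; exact: wB.
Qed.

Lemma prob_joint_event_cons i A J B : measurable A -> uniq (i :: J) ->
  (forall j, j \in J -> measurable (B j)) ->
  P (Y i @^-1` A `&` joint_event J B) = (P (Y i @^-1` A) * P (joint_event J B))%E.
Proof.
move=> mA /= /andP[iJ uJ] mB; rewrite -joint_event_cons// Y_indep/=; last 2 first.
- by rewrite iJ.
- by move=> j; rewrite inE; case: eqVneq => //= _; exact: mB.
rewrite big_cons/= eqxx Y_indep//; congr (_ * _)%E.
rewrite big_seq [RHS]big_seq; apply: eq_bigr => j jJ.
by case: eqP => // ji; rewrite ji (negbTE iJ) in jJ.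
Qed.

Definition family_sum s (w : T) : R := \sum_(i <- s) Y i w.

Lemma measurable_family_sum s : measurable_fun [set: T] (family_sum s).
Proof. by apply: measurable_sum => i. Qed.

HB.instance Definition _ s :=
  @isMeasurableFun.Build _ _ _ _ (family_sum s) (measurable_family_sum s).

Lemma family_sum_indep_joint_event s A J B : measurable A -> uniq (s ++ J) ->
  (forall j, j \in J -> measurable (B j)) ->
  P (family_sum s @^-1` A `&` joint_event J B) =
  (P (family_sum s @^-1` A) * P (joint_event J B))%E.
Proof.
elim: s A J B => [|i s IHs] A J B mA uJ mB.
  have sum_nil w : family_sum [::] w = 0 by rewrite /family_sum big_nil.
  have [A0|A0] := pselect (A 0).
    rewrite (_ : _ @^-1` A = setT) ?setTI ?probability_setT ?mul1e//.
    by apply/seteqP; split => // w _; rewrite /preimage/= sum_nil.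
  rewrite (_ : _ @^-1` A = set0) ?set0I ?measure0 ?mul0e//.
  by apply/seteqP; split => // w; rewrite /preimage/= sum_nil.
have u_s_iJ : uniq (s ++ i :: J) by rewrite -cat1s uniq_catCA.
have uiJ : uniq (i :: J) by move: u_s_iJ; rewrite cat_uniq => /and3P[].
have [iJ _] := andP uiJ.
pose D := [set z : R * R | A (z.1 + z.2)].
have mD : measurable D.
  rewrite -[D]setTI; exact: (measurable_funD measurable_fst measurable_snd).
have -> : family_sum (i :: s) @^-1` A = rv_pair (Y i) (family_sum s) @^-1` D.
  by apply/seteqP; split => w; rewrite /preimage/= /family_sum big_cons.
apply: rv_pair_indep_event => //; first exact: measurable_joint_event.
move=> A1 A2 mA1 mA2.
have mB1 j : j \in i :: J -> measurable ([eta B with i |-> A1] j).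
  by rewrite inE/=; case: eqVneq => //= _; exact: mB.
rewrite setIAC setIC -joint_event_cons// IHs// joint_event_cons//.
rewrite prob_joint_event_cons// muleA; congr (_ * _)%E.
rewrite setIC -(joint_event1 i (fun=> A1)) IHs//.
by move: u_s_iJ; rewrite -cat_rcons cat_uniq cats1 => /and3P[].
Qed.

Lemma family_sum_indep s i : uniq (i :: s) -> indep_pair P (family_sum s) (Y i).
Proof.
move=> uis A B mA mB; rewrite -(joint_event1 i (fun=> B)).
by apply: family_sum_indep_joint_event => //; rewrite cats1 rcons_uniq.
Qed.

End independent_families.

Lemma mutually_independent_comp d (T : measurableType d) (R : realType)
    (P : probability T R) (I : eqType) (Y : I -> T -> R) (g : I -> R -> R) :
  (forall i, measurable_fun [set: R] (g i)) -> mutually_independent P Y ->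
  mutually_independent P (fun i => g i \o Y i).
Proof.
move=> mg indY J B uJ mB; have mgB j : j \in J -> measurable (g j @^-1` B j).
  by move=> /mB mBj; rewrite -[X in measurable X]setTI; exact: mg.
exact: indY (fun j => g j @^-1` B j) uJ mgB.
Qed.

(** * Random sums *)

Section natural_random_variable.
Context d (T : measurableType d) (R : realType) (P : probability T R).
Variable N : T -> nat.
Hypothesis mN : forall k, measurable (N @^-1` [set k]).

Lemma measurable_fun_natr : measurable_fun [set: T] (fun w => (N w)%:R : R).
Proof.
move=> _ A mA; rewrite setTI.
rewrite (_ : _ @^-1` A = \bigcup_(k in [set k : nat | A k%:R]) (N @^-1` [set k])).
  by apply: bigcup_measurable => k _; exact: mN.
by apply/seteqP; split => [w Aw|w [k Ak /= Nk]]; [exists (N w)|rewrite /preimage/= Nk].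
Qed.

Let ltN n := [set w | (N w < n)%N].

Let ltNS n : ltN n.+1 = ltN n `|` N @^-1` [set n].
Proof.
apply/seteqP; split => w; rewrite /ltN/= ltnS.
  by rewrite leq_eqVlt => /orP[/eqP|]; [right|left].
by case=> [/ltnW|->].
Qed.

Let measurable_ltN n : measurable (ltN n).
Proof.
elim: n => [|n IHn]; last by rewrite ltNS; exact: measurableU.
by rewrite (_ : ltN 0 = set0)//; apply/seteqP; split.
Qed.

Let sum_Rintegral_preimage n (f : T -> R) : P.-integrable [set: T] (EFin \o f) ->
  \sum_(0 <= k < n) \int[P]_(w in N @^-1` [set k]) f w = \int[P]_(w in ltN n) f w.
Proof.
move=> int_f; elim: n => [|n IHn].
  by rewrite big_geq// (_ : ltN 0 = set0) ?Rintegral_set0//; apply/seteqP; split.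
rewrite big_nat_recr//= IHn ltNS Rintegral_setU//.
- by apply: integrableS int_f => //; exact: measurableU.
- by rewrite /ltN; apply/disj_setPS => w [/= ltNn Nn]; rewrite Nn ltnn in ltNn.
Qed.

Lemma cvg_sum_Rintegral_preimage (f : T -> R) : P.-integrable [set: T] (EFin \o f) ->
  (\sum_(0 <= k < n) \int[P]_(w in N @^-1` [set k]) f w) @[n --> \oo] --> \int[P]_w f w.
Proof.
move=> int_f; under eq_fun do rewrite sum_Rintegral_preimage//.
pose f_ n w := ((f \_ (ltN n)) w)%:E.
have mf : measurable_fun [set: T] f by apply/measurable_EFinP; exact: measurable_int int_f.
have mf_ n : measurable_fun [set: T] (f_ n).
  apply/measurable_EFinP/(measurable_restrictT _ (measurable_ltN n)).
  exact: measurable_funTS.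
have [||||_ _ cvg_f] := @dominated_convergence _ T R P setT measurableT f_
    (EFin \o f) (fun w => `|(f w)%:E|%E) mf_.
- exact/measurable_EFinP.
- apply: aeW => w _; apply: cvg_near_cst; near=> n.
  rewrite /f_ patchE mem_set//=; near: n; exact: nbhs_infty_gt.
- exact: integrable_abse.
- by apply: aeW => w n _; rewrite /f_ patchE; case: ifPn => //; rewrite abse0.
apply: fine_cvg; rewrite fineK; last exact: integrable_fin_num.
apply: cvg_trans cvg_f; apply: near_eq_cvg; apply: nearW => n /=.
by rewrite [RHS]integral_mkcond; apply: eq_integral => w _; rewrite /f_ !patchE; case: ifPn.
Unshelve. all: by end_near. Qed.

Lemma ge0_integrable_of_sum_preimage (f : T -> R) M : measurable_fun [set: T] f ->
  (forall w, 0 <= f w) ->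
  (forall k, P.-integrable (N @^-1` [set k]) (EFin \o f)) ->
  (forall n, \sum_(0 <= k < n) \int[P]_(w in N @^-1` [set k]) f w <= M) ->
  P.-integrable [set: T] (EFin \o f).
Proof.
move=> mf f0 int_f fM; apply/integrableP; split; first exact/measurable_EFinP.
have -> : [set: T] = \bigcup_k (N @^-1` [set k]).
  by apply/esym/seteqP; split => // w _; exists (N w).
rewrite ge0_integral_bigcup//; last 2 first.
- by apply/measurable_EFinP; apply: measurableT_comp => //; exact: measurable_funTS.
- apply/trivIsetP => i j _ _ ij; apply/seteqP; split => // w [/= -> /eqP].
  by rewrite (negbTE ij).
apply: (@le_lt_trans _ _ M%:E); last exact: ltry.
apply: lime_le; first by apply: is_cvg_nneseries => k _ _; exact: integral_ge0.
apply: nearW => n.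
have RintegralE k : (\int[P]_(w in N @^-1` [set k]) `|(EFin \o f) w| =
    (\int[P]_(w in N @^-1` [set k]) f w)%R%:E)%E.
  rewrite /Rintegral fineK; last exact: integrable_fin_num.
  by apply: eq_integral => w _; rewrite /= ger0_norm.
by under eq_bigr do rewrite RintegralE; rewrite sumEFin lee_fin.
Qed.

End natural_random_variable.

Section shift_expectation.
Context d (T : measurableType d) (R : realType) (P : probability T R).
Implicit Types (g : R -> R) (Z : T -> R).

Definition shift_expect Z g (s : R) : R := \int[P]_w g (s + Z w).

Lemma integrable_shift_expect Z C g s : C.-lipschitz g ->
  P.-integrable [set: T] (EFin \o Z) ->
  P.-integrable [set: T] (EFin \o (fun w => g (s + Z w))).
Proof.
move=> gC int_Z.
exact: (@klipschitz_integrable _ _ _ _ _ _ (fun w => s + Z w) gC (integrable_add_cst s int_Z)).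
Qed.

End shift_expectation.

Section partial_sums.
Context d (T : measurableType d) (R : realType) (P : probability T R).
Variables (X : nat -> {RV P >-> R}) (N : T -> nat).

Definition psum n (w : T) : R := \sum_(i < n) X i w.

Lemma measurable_psum n : measurable_fun [set: T] (psum n).
Proof. by apply: measurable_sum => i. Qed.

HB.instance Definition _ n := @isMeasurableFun.Build _ _ _ _ (psum n) (measurable_psum n).

Lemma psum0 w : psum 0 w = 0. Proof. by rewrite /psum big_ord0. Qed.

Lemma psumS n w : psum n.+1 w = psum n w + X n w.
Proof. by rewrite /psum big_ord_recr. Qed.

Definition random_psum (w : T) : R := psum (N w) w.

Definition steps_and_index (o : option nat) : T -> R :=
  match o with None => fun w => (N w)%:R | Some i => X i end.

Hypothesis mN : forall k, measurable (N @^-1` [set k]).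

Lemma measurable_random_psum : measurable_fun [set: T] random_psum.
Proof.
move=> _ A mA; rewrite setTI.
rewrite (_ : random_psum @^-1` A = \bigcup_k (psum k @^-1` A `&` N @^-1` [set k])).
  by apply: bigcup_measurable => k _; apply: measurableI => //; exact: measurable_funPTI.
apply/seteqP; split => [w Aw|w [k _ [Ak /= Nk]]]; first by exists (N w).
by rewrite /preimage/= /random_psum Nk.
Qed.

Definition natr_rv : {RV P >-> R} := MeasurableFun.Pack (MeasurableFun.Class
  (isMeasurableFun.Build _ _ _ _ _ (measurable_fun_natr mN))).

Hypothesis indX : mutually_independent P steps_and_index.

Let Y (o : option nat) : {RV P >-> R} :=
  match o with None => natr_rv | Some i => X i end.

Let indY : mutually_independent P (fun o => Y o : T -> R).
Proof. by have -> : (fun o => Y o : T -> R) = steps_and_index by apply/funext => -[]. Qed.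

Let steps n := [seq Some i | i <- index_iota 0 n].

Let psum_family_sum n : psum n = family_sum Y (steps n).
Proof. by apply/funext => w; rewrite /family_sum big_map big_mkord. Qed.

Let uniq_steps n : uniq (steps n).
Proof. by rewrite map_inj_uniq ?iota_uniq// => i j []. Qed.

Lemma psum_indep_step n : indep_pair P (psum n) (X n).
Proof.
rewrite psum_family_sum; apply: (family_sum_indep indY (i := Some n)).
rewrite /= uniq_steps andbT; apply/mapP => -[i + [ni]].
by rewrite ni mem_index_iota ltnn.
Qed.

Lemma psum_indep_index n : indep_pair P (psum n) natr_rv.
Proof.
rewrite psum_family_sum; apply: (family_sum_indep indY (i := None)).
by rewrite /= uniq_steps andbT; apply/mapP => -[].
Qed.

Hypothesis int_X : forall i, P.-integrable [set: T] (EFin \o X i).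

Lemma integrable_psum n : P.-integrable [set: T] (EFin \o psum n).
Proof.
rewrite (_ : EFin \o psum n = fun w => (\sum_(i < n) (X i w)%:E)%E).
  by apply: integrable_sum => // i _; exact: int_X.
by apply/funext => w; rewrite /psum /= sumEFin.
Qed.

Lemma Rintegral_norm_psum_le M n : (forall i, \int[P]_w `|X i w| <= M) ->
  \int[P]_w `|psum n w| <= n%:R * M.
Proof.
move=> XM; elim: n => [|n IHn].
  under eq_Rintegral do rewrite psum0 normr0.
  by rewrite mul0r Rintegral_cst_probability.
have int_S := integrable_abse (integrable_psum n).
have int_Xn := integrable_abse (int_X n).
apply: (@le_trans _ _ (\int[P]_w (`|psum n w| + `|X n w|))).
  apply: le_Rintegral => //.
  - exact: integrable_abse (integrable_psum n.+1).
  - exact: integrableD _ int_S int_Xn.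
  - by move=> w _; rewrite psumS ler_normD.
by rewrite RintegralD// -natr1 mulrDl mul1r lerD.
Qed.

Section lipschitz_test_function.
Variables (C : R) (g : R -> R).
Hypothesis g_lip : C.-lipschitz g.

Let mg : measurable_fun [set: R] g. Proof. exact: klipschitz_measurable g_lip. Qed.

Let mg_add : measurable_fun [set: R * R] (fun z => g (z.1 + z.2)).
Proof.
by apply: (measurableT_comp mg); exact: measurable_funD measurable_fst measurable_snd.
Qed.

Let int_g_add n : P.-integrable [set: T] (fun w => (g (psum n w + X n w))%:E).
Proof.
have := klipschitz_integrable g_lip (integrable_psum n.+1).
by congr (_.-integrable _ _); apply/funext => w; rewrite /= psumS.
Qed.

Lemma integrable_shift_expect_psum n :
  P.-integrable [set: T] (EFin \o (shift_expect P (X n) g \o psum n)).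
Proof.
apply: (integrable_indep_pair (psum_indep_step n) mg_add (int_g_add n)) => s.
exact: integrable_shift_expect g_lip (int_X n).
Qed.

Lemma Rintegral_psumS n :
  \int[P]_w g (psum n.+1 w) = \int[P]_w shift_expect P (X n) g (psum n w).
Proof.
rewrite -(Rintegral_indep_pair (psum_indep_step n) mg_add (int_g_add n)) => [|s].
  by apply: eq_Rintegral => w _; rewrite psumS.
exact: integrable_shift_expect g_lip (int_X n).
Qed.

Lemma Rintegral_random_psum_eq k :
  \int[P]_(w in N @^-1` [set k]) g (random_psum w) =
  fine (P (N @^-1` [set k])) * \int[P]_w g (psum k w).
Proof.
have preimageN : natr_rv @^-1` [set k%:R] = N @^-1` [set k].
  by apply/seteqP; split => w /= => [/eqP|->//]; rewrite eqr_nat => /eqP.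
rewrite -preimageN -(Rintegral_indep_event (psum_indep_index k))//; last first.
  exact: klipschitz_integrable g_lip (integrable_psum k).
by rewrite preimageN; apply: eq_Rintegral => w /set_mem /= Nk; rewrite /random_psum Nk.
Qed.

End lipschitz_test_function.
End partial_sums.

Section geometric_sums.
Context d (T : measurableType d) (R : realType) (P : probability T R).
Variables (X : nat -> {RV P >-> R}) (N : T -> nat) (p M : R).
Hypothesis p01 : 0 < p < 1.
Hypothesis geoN : geometric_rv P N p.
Hypothesis indX : mutually_independent P (steps_and_index X N).
Hypothesis int_X : forall i, P.-integrable [set: T] (EFin \o X i).
Hypothesis norm_X : forall i, \int[P]_w `|X i w| <= M.

Let p_gt0 : 0 < p. Proof. by case/andP: p01. Qed.
Let mN : forall k, measurable (N @^-1` [set k]) := geoN.1.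

Let prob_N0 : fine (P (N @^-1` [set 0%N])) = 0.
Proof.
pose u k := \int[P]_(w in N @^-1` [set k]) cst 1 w.
have uE k : u k = fine (P (N @^-1` [set k])) by rewrite /u Rintegral_cst// mul1r.
have mean1 : is_geometric_mean p (cst 1) (\int[P]_w cst 1 w - u 0%N).
  apply: is_geometric_mean_series (cvg_sum_Rintegral_preimage mN _) => [j|].
    by rewrite -/(u _) uE geoN.2//= mulr1.
  exact: finite_measure_integrable_cst.
have := is_geometric_mean_unique mean1 (is_geometric_mean_cst p01 (l := 1)).
by rewrite Rintegral_cst_probability uE; lra.
Qed.

Lemma integrable_random_psum :
  P.-integrable [set: T] (EFin \o random_psum X N).
Proof.
have m_norm : measurable_fun [set: T] (fun w => `|random_psum X N w|).
  by apply: measurableT_comp => //; exact: measurable_random_psum mN.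
have M0 : 0 <= M by apply: le_trans (norm_X 0%N); exact: Rintegral_ge0.
suff int_norm : P.-integrable [set: T] (EFin \o (fun w => `|random_psum X N w|)).
  apply: le_integrable int_norm => //.
    by apply/measurable_EFinP; exact: measurable_random_psum mN.
  by move=> w _; rewrite /= normr_id.
apply: (ge0_integrable_of_sum_preimage mN (M := p^-1 * M)) => // [k|n].
  apply: eq_integrable (integrableS _ _ _ (integrable_abse (integrable_psum int_X k))) => //.
  by move=> w /set_mem /= Nk; rewrite /random_psum Nk.
under eq_bigr do rewrite (Rintegral_random_psum_eq mN indX int_X klipschitz_norm).
case: n => [|n]; first by rewrite big_geq// mulr_ge0// invr_ge0 ltW.
rewrite big_nat_recl//= prob_N0 mul0r add0r big_mkord.
apply: (@le_trans _ _ (\sum_(j < n) p * (1 - p) ^+ j * j.+1%:R * M)).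
  apply: ler_sum => j _; rewrite geoN.2//= -[leRHS]mulrA ler_wpM2l//.
    by rewrite mulr_ge0 ?exprn_ge0 ?subr_ge0 ?ltW//; case/andP: p01.
  exact: Rintegral_norm_psum_le.
by rewrite -mulr_suml ler_wpM2r// sum_geometricM_le.
Qed.

Section lipschitz_test_function.
Variables (C : R) (g : R -> R).
Hypothesis g_lip : C.-lipschitz g.

Lemma is_geometric_mean_random_psum :
  is_geometric_mean p (fun j => \int[P]_w g (psum X j.+1 w))
    (\int[P]_w g (random_psum X N w)).
Proof.
have int_g := klipschitz_integrable g_lip integrable_random_psum.
pose u k := \int[P]_(w in N @^-1` [set k]) g (random_psum X N w).
have u0 : u 0%N = 0.
  by rewrite /u (Rintegral_random_psum_eq mN indX int_X g_lip) prob_N0 mul0r.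
rewrite -[X in is_geometric_mean _ _ X]subr0 -u0.
apply: is_geometric_mean_series (cvg_sum_Rintegral_preimage mN int_g) => j.
by rewrite /u (Rintegral_random_psum_eq mN indX int_X g_lip) geoN.2.
Qed.

Lemma is_geometric_mean_random_psum_pred :
  is_geometric_mean p (fun j => \int[P]_w g (psum X j w))
    (p * g 0 + (1 - p) * \int[P]_w g (random_psum X N w)).
Proof.
have <- : \int[P]_w g (psum X 0 w) = g 0.
  by under eq_Rintegral do rewrite psum0; exact: Rintegral_cst_probability.
exact: is_geometric_mean_shift is_geometric_mean_random_psum.
Qed.

Lemma is_geometric_mean_increment :
  is_geometric_mean p
    (fun j => \int[P]_w g (psum X j.+1 w) - \int[P]_w g (psum X j w))
    (p * (\int[P]_w g (random_psum X N w) - g 0)).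
Proof.
have := is_geometric_meanB is_geometric_mean_random_psum
  is_geometric_mean_random_psum_pred.
by congr (is_geometric_mean _ _ _); ring.
Qed.

End lipschitz_test_function.

Lemma random_psum_linear_step C D (g k : R -> R) a c :
  C.-lipschitz g -> D.-lipschitz k ->
  (forall j s, shift_expect P (X j) g s = a * g s + c * k s) ->
  \int[P]_w g (random_psum X N w) =
    a * (p * g 0 + (1 - p) * \int[P]_w g (random_psum X N w)) +
    c * (p * k 0 + (1 - p) * \int[P]_w k (random_psum X N w)).
Proof.
move=> gC kD step; apply: is_geometric_mean_unique (is_geometric_mean_random_psum gC) _.
have psum_step j : \int[P]_w g (psum X j.+1 w) =
    a * \int[P]_w g (psum X j w) + c * \int[P]_w k (psum X j w).
  have int_g := klipschitz_integrable gC (integrable_psum int_X j).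
  have int_k := klipschitz_integrable kD (integrable_psum int_X j).
  rewrite (Rintegral_psumS mN indX int_X gC); under eq_Rintegral do rewrite step.
  rewrite RintegralD// ?RintegralZl//.
  - exact: (integrableZl measurableT a int_g).
  - exact: (integrableZl measurableT c int_k).
under eq_fun do rewrite psum_step.
exact: (is_geometric_meanD (is_geometric_meanZl (is_geometric_mean_random_psum_pred gC))
  (is_geometric_meanZl (is_geometric_mean_random_psum_pred kD))).
Qed.

Section stein_method.
Variables (f h phi : R -> R) (Cf Ch Cphi E : R).
Hypotheses (f_lip : Cf.-lipschitz f) (h_lip : Ch.-lipschitz h).
Hypothesis phi_lip : Cphi.-lipschitz phi.

Let int_psum C g n : C.-lipschitz g ->
  P.-integrable [set: T] (EFin \o (g \o psum X n)).
Proof. by move=> gC; exact: klipschitz_integrable gC (integrable_psum int_X n). Qed.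

Hypothesis step_le : forall j s,
  `|shift_expect P (X j) f s - f s - p * shift_expect P (X j) (f \- h) s|
    <= p * E - (shift_expect P (X j) phi s - phi s).

Let fh_lip : (Cf + Ch).-lipschitz (f \- h). Proof. exact: klipschitzB. Qed.

Let psum_step_le j :
  `|\int[P]_w f (psum X j.+1 w) - \int[P]_w f (psum X j w) -
    p * \int[P]_w (f \- h) (psum X j.+1 w)|
  <= p * E - (\int[P]_w phi (psum X j.+1 w) - \int[P]_w phi (psum X j w)).
Proof.
have int_step C g (gC : C.-lipschitz g) := integrable_shift_expect_psum mN indX int_X gC j.
have int_f := integrableB measurableT (int_step _ _ f_lip) (int_psum j f_lip).
have int_fh := integrableZl measurableT p (int_step _ _ fh_lip).
have int_phi := integrableB measurableT (int_step _ _ phi_lip) (int_psum j phi_lip).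
have int_cst := finite_measure_integrable_cst P (p * E) measurableT.
rewrite (Rintegral_psumS mN indX int_X f_lip) (Rintegral_psumS mN indX int_X fh_lip).
rewrite (Rintegral_psumS mN indX int_X phi_lip).
rewrite -RintegralZl//; last exact: int_step fh_lip.
rewrite -[X in `|X - _|]RintegralB//; [|exact: int_step f_lip|exact: int_psum f_lip].
rewrite -[X in _ <= _ - X]RintegralB//;
  [|exact: int_step phi_lip|exact: int_psum phi_lip].
rewrite -RintegralB// -[X in _ <= X - _](Rintegral_cst_probability P) -RintegralB//.
apply: ler_norm_Rintegral => [||w]; last exact: step_le.
- exact: (integrableB measurableT int_f int_fh).
- exact: (integrableB measurableT int_cst int_phi).
Qed.

Lemma random_psum_stein_bound :
  `|\int[P]_w h (random_psum X N w) - f 0|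
    <= E - (\int[P]_w phi (random_psum X N w) - phi 0).
Proof.
have mean_le := ler_norm_geometric_mean p01
  (is_geometric_meanB (is_geometric_mean_increment f_lip)
    (is_geometric_meanZl (k := p) (is_geometric_mean_random_psum fh_lip)))
  (is_geometric_meanB (is_geometric_mean_cst p01 (l := p * E))
    (is_geometric_mean_increment phi_lip)) psum_step_le.
rewrite -(ler_pM2l p_gt0) mulrBr (le_trans _ mean_le)//.
rewrite [\int[P]_w (f \- h) _]RintegralB//; last 2 first.
- exact: klipschitz_integrable f_lip integrable_random_psum.
- exact: klipschitz_integrable h_lip integrable_random_psum.
rewrite -mulrBr normrM [`|p|]gtr0_norm// ler_wpM2l ?(ltW p_gt0)//.
rewrite (_ : _ - (_ - _) = \int[P]_x h (random_psum X N x) - f 0)//; ring.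
Qed.

End stein_method.
End geometric_sums.

(** * Quantile coupling *)

Lemma eq_probability_itvoy (R : realType) (P Q : probability R R) :
  (forall x : R, P `]x, +oo[%classic = Q `]x, +oo[%classic) -> forall A, measurable A -> P A = Q A.
Proof.
move=> PQ A mA.
apply: (measure_unique (@RGenOInfty.G R) (fun n => `](- n%:R)%R, +oo[%classic)) => //.
- exact: RGenOInfty.measurableE.
- move=> _ _ [x ->] [y ->]; exists (Num.max x y).
  by apply/seteqP; split => z /=; rewrite !in_itv/= !andbT gt_max; [case=> -> ->|move=> /andP[]].
- by move=> n; exists (- n%:R).
- apply/seteqP; split => // x _; exists (Num.truncn `|x|).+1 => //=.
  rewrite in_itv/= andbT ltrNl; apply: le_lt_trans (truncnS_gt _).
  by rewrite -normrN ler_norm.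
- by move=> _ [x ->]; exact: PQ.
- by move=> n; rewrite (le_lt_trans (probability_le1 _ _))// ltry.
Qed.

Lemma measurable_sublevel d (T : measurableType d) (R : realType) (W : T -> R) x :
  measurable_fun [set: T] W -> measurable [set w | W w <= x].
Proof.
move=> mW; rewrite (_ : [set _ | _] = W @^-1` `]-oo, x]).
  by rewrite -[X in measurable X]setTI; exact: mW.
by apply/seteqP; split => w /=; rewrite in_itv.
Qed.

Section distribution_function.
Context d (T : measurableType d) (R : realType) (P : probability T R).
Variable X : {RV P >-> R}.

Let cdfE x : cdf_rv P X x = fine (cdf X x).
Proof. by rewrite /cdf_rv /cdf /distribution /pushforward; congr (fine (P _)). Qed.

Lemma cdf_rv_nondecreasing : {homo cdf_rv P X : x y / x <= y}.
Proof.
by move=> x y xy; rewrite !cdfE fine_le ?fin_num_measure//; exact: cdf_nondecreasing.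
Qed.

Lemma cdf_rv_ge0 x : 0 <= cdf_rv P X x. Proof. by rewrite cdfE fine_ge0. Qed.

Lemma cdf_rv_le1 x : cdf_rv P X x <= 1.
Proof. by rewrite cdfE -lee_fin fineK ?fin_num_measure//; exact: cdf_le1. Qed.

Lemma cvg_cdf_rvy1 : cdf_rv P X x @[x --> +oo] --> (1 : R).
Proof. by under eq_fun do rewrite cdfE; apply: fine_cvg; exact: cvg_cdfy1. Qed.

Lemma cvg_cdf_rvNy0 : cdf_rv P X x @[x --> -oo] --> (0 : R).
Proof. by under eq_fun do rewrite cdfE; apply: fine_cvg; exact: cvg_cdfNy0. Qed.

Lemma cdf_rv_right_continuous x : cdf_rv P X y @[y --> x^'+] --> cdf_rv P X x.
Proof.
rewrite cdfE; under eq_fun do rewrite cdfE.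
by apply: fine_cvg; rewrite fineK ?fin_num_measure//; exact: cdf_right_continuous.
Qed.

Lemma prob_gt_cdf_rv x : P (X @^-1` `]x, +oo[) = (1 - cdf_rv P X x)%:E.
Proof.
have -> : X @^-1` `]x, +oo[ = ~` [set w | X w <= x].
  by apply/seteqP; split => w /=; rewrite in_itv/= andbT ltNge => /negP.
have mX : measurable [set w | X w <= x] by exact: measurable_sublevel.
by rewrite probability_setC// /cdf_rv EFinB fineK// fin_num_measure.
Qed.

Let superlevel_nonempty u : u < 1 -> [set x | u <= cdf_rv P X x] !=set0.
Proof.
move=> u1; have := cvgr_gt _ cvg_cdf_rvy1 _ u1 => -[y [yr]] gt_u; exists (y + 1) => /=.
by apply: ltW; apply: gt_u; rewrite ltrDl.
Qed.

Let superlevel_has_lbound u : 0 < u -> has_lbound [set x | u <= cdf_rv P X x].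
Proof.
move=> u0; have := cvgr_lt _ cvg_cdf_rvNy0 _ u0 => -[y [yr]] lt_u; exists (y - 1) => z /= uz.
rewrite leNgt; apply/negP => zy.
suff : cdf_rv P X z < u by rewrite ltNge uz.
by apply: lt_u; lra.
Qed.

Lemma gen_inv_le u x : 0 < u < 1 -> (gen_inv (cdf_rv P X) u <= x) = (u <= cdf_rv P X x).
Proof.
move=> /andP[u0 u1].
have lb := superlevel_has_lbound u0; have ne := superlevel_nonempty u1.
apply/idP/idP => [ux|]; last exact: ge_inf.
have above e : 0 < e -> u <= cdf_rv P X (x + e).
  move=> e0; have [z /= uz zu] := inf_adherent e0 (conj ne lb).
  apply: le_trans uz _; apply: cdf_rv_nondecreasing; apply: ltW.
  by apply: (lt_le_trans zu); rewrite lerD2r.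
apply: cvgr_to_ge (@cdf_rv_right_continuous x) _; near=> y.
rewrite -[y](subrKC x); apply: above; rewrite subr_gt0; near: y.
exact: nbhs_right_gt.
Unshelve. all: by end_near. Qed.

(* Outside of ]0, 1[ the infimum in [gen_inv] may be taken over an empty or
   unbounded set. *)
Definition quantile (u : R) : R := if 0 < u < 1 then gen_inv (cdf_rv P X) u else 0.

Lemma quantile_superlevel x :
  [set u | 0 < u < 1 /\ x < quantile u] = `]cdf_rv P X x, 1%R[%classic.
Proof.
apply/seteqP; split => u /=; rewrite in_itv/=.
  by move=> [u01]; rewrite /quantile u01 ltNge gen_inv_le// -ltNge => ->; case/andP: u01.
move=> /andP[Fu u1]; have u01 : 0 < u < 1 by rewrite u1 (le_lt_trans (cdf_rv_ge0 x)).
by split => //; rewrite /quantile u01 ltNge gen_inv_le// -ltNge.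
Qed.

Lemma measurable_quantile : measurable_fun [set: measurableTypeR R] quantile.
Proof.
apply: (measurability _ (RGenOInfty.measurableE R)) => _ [_ [x ->] <-]; rewrite setTI.
rewrite (_ : _ @^-1` _ = `]cdf_rv P X x, 1%R[ `|` (~` `]0, 1[ `&` [set u | x < 0])).
  apply: measurableU => //; apply: measurableI; first exact: measurableC.
  have [x0|x0] := ltP x 0.
    by rewrite (_ : [set _ | _] = setT)//; apply/seteqP; split.
  by rewrite (_ : [set _ | _] = set0)//; apply/seteqP; split.
rewrite -quantile_superlevel; apply/seteqP; split => u /=; rewrite !in_itv/= andbT.
  move=> xu; have [u01|u01] := boolP (0 < u < 1); [by left|right].
  by move: xu; rewrite /quantile (negbTE u01); split => //; exact/negP.
by move=> [[]//|[/negP u01 x0]]; rewrite /quantile (negbTE u01).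
Qed.

Definition unif01 : set (measurableTypeR R) -> \bar R :=
  mrestr (@lebesgue_measure R) (measurable_itv `]0%R, 1%R[).

HB.instance Definition _ := Measure.on unif01.

Lemma unif01_setT : unif01 [set: R] = 1%E.
Proof. by rewrite /unif01 /mrestr setTI lebesgue_measure_itv/= lte_fin ltr01 oppr0 adde0. Qed.

HB.instance Definition _ := Measure_isProbability.Build _ _ _ unif01 unif01_setT.

Definition quantile_rv : {RV unif01 >-> R} := MeasurableFun.Pack (MeasurableFun.Class
  (isMeasurableFun.Build _ _ _ _ _ measurable_quantile)).

Lemma quantile_law (A : set R) : measurable A ->
  distribution P X A = distribution unif01 quantile_rv A.
Proof.
apply: eq_probability_itvoy => x; apply: etrans (prob_gt_cdf_rv x) _; apply/esym.
change (unif01 (quantile @^-1` `]x, +oo[) = (1 - cdf_rv P X x)%:E).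
rewrite /unif01 /mrestr.
have -> : quantile @^-1` `]x, +oo[ `&` `]0%R, 1%R[ = `]cdf_rv P X x, 1%R[%classic.
  rewrite -quantile_superlevel.
  by apply/seteqP; split => u /=; rewrite !in_itv/= andbT => -[].
rewrite lebesgue_measure_itv/= lte_fin; case: ltP => [//|F1].
by congr EFin; apply/eqP; rewrite eq_sym subr_eq0 eq_le F1 cdf_rv_le1.
Qed.

Lemma Rintegral_quantile (g : R -> R) : measurable_fun [set: R] g ->
  P.-integrable [set: T] (EFin \o (g \o X)) ->
  unif01.-integrable [set: R] (EFin \o (g \o quantile)) ->
  \int[P]_w g (X w) = \int[unif01]_u g (quantile u).
Proof.
move=> mg int_gX int_gq; have mEg : measurable_fun [set: R] (EFin \o g) by exact/measurable_EFinP.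
rewrite /Rintegral; congr fine.
have : (\int[distribution P X]_x (EFin \o g) x =
    \int[distribution unif01 quantile_rv]_x (EFin \o g) x)%E.
  by apply: eq_measure_integral => A mA _; exact: quantile_law.
by rewrite !integral_distribution.
Qed.

End distribution_function.

Lemma gen_inv_cdf_rv_scale d (T : measurableType d) (R : realType)
    (P : probability T R) (X : {RV P >-> R}) (k u : R) : 0 < k -> 0 < u < 1 ->
  gen_inv (cdf_rv P (k \o* X)) u = gen_inv (cdf_rv P X) u * k.
Proof.
move=> k0 u01.
have cdfZ x : cdf_rv P (k \o* X) x = cdf_rv P X (x / k).
  by congr (fine (P _)); apply/seteqP; split => w; rewrite /= ler_pdivlMr.
have gen_invZ x : (gen_inv (cdf_rv P (k \o* X)) u <= x) = (gen_inv (cdf_rv P X) u * k <= x).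
  by rewrite gen_inv_le// cdfZ -gen_inv_le// ler_pdivlMr.
by apply/eqP; rewrite eq_le gen_invZ lexx -gen_invZ lexx.
Qed.

Lemma quantile_coupling d d' (T : measurableType d) (T' : measurableType d')
    (R : realType) (P : probability T R) (Q : probability T' R)
    (X : {RV P >-> R}) (Z : {RV Q >-> R}) (e M : R) (g osc : R -> R) :
  (forall u, 0 < u < 1 -> `|gen_inv (cdf_rv P X) u - gen_inv (cdf_rv Q Z) u| <= e) ->
  measurable_fun [set: R] g -> measurable_fun [set: R] osc ->
  (forall x, `|g x| <= M) -> (forall x, `|osc x| <= M) ->
  (forall x y, `|x - y| <= e -> `|g x - g y| <= osc y) ->
  `|\int[P]_w g (X w) - \int[Q]_w g (Z w)| <= \int[Q]_w osc (Z w).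
Proof.
move=> quantile_le mg mosc gM oscM g_osc.
have e0 : 0 <= e by apply: le_trans (quantile_le 2^-1 _); rewrite ?normr_ge0//; lra.
have int_bounded d0 (T0 : measurableType d0) (P0 : probability T0 R)
    (Y : {RV P0 >-> R}) (f : R -> R) : measurable_fun [set: R] f ->
    (forall x, `|f x| <= M) -> P0.-integrable [set: T0] (EFin \o (f \o Y)).
  by move=> mf fM; apply: integrable_bounded => [|w]; [exact: measurableT_comp|exact: fM].
have int_gX := int_bounded _ _ _ (quantile_rv X) _ mg gM.
have int_gZ := int_bounded _ _ _ (quantile_rv Z) _ mg gM.
have int_oscZ := int_bounded _ _ _ (quantile_rv Z) _ mosc oscM.
rewrite (Rintegral_quantile mg _ int_gX); last exact: int_bounded.
rewrite (Rintegral_quantile mg _ int_gZ); last exact: int_bounded.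
rewrite (Rintegral_quantile mosc _ int_oscZ); last exact: int_bounded.
rewrite -RintegralB//; apply: ler_norm_Rintegral => //.
  exact: (integrableB measurableT int_gX int_gZ).
move=> u; apply: g_osc; rewrite /quantile; case: ifPn => u01; first exact: quantile_le.
by rewrite subrr normr0.
Qed.

(** * One step of the random sum *)

Section centered_step.
Context d (T : measurableType d) (R : realType) (P : probability T R).
Variable X : {RV P >-> R}.
Hypothesis EX : \int[P]_w X w = 0.
Hypothesis int_X2 : P.-integrable [set: T] (EFin \o (fun w => X w ^+ 2)).

Let int_X : P.-integrable [set: T] (EFin \o X).
Proof. exact: integrable_of_sqr int_X2. Qed.

Lemma klipschitz_shift_expect C g s : C.-lipschitz g ->
  `|shift_expect P X g s - g s| <= C * \int[P]_w `|X w|.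
Proof.
move=> gC; have int_g := integrable_shift_expect s gC int_X.
have int_gs := finite_measure_integrable_cst P (g s) measurableT.
have int_absX := integrable_abse int_X.
rewrite -[X in _ - X](Rintegral_cst_probability P) -RintegralB// -RintegralZl//.
apply: ler_norm_Rintegral => [||w].
- exact: (integrableB measurableT int_g int_gs).
- exact: (integrableZl measurableT C int_absX).
- by have /klipschitzP/(_ (s + X w) s) := gC; rewrite [s + _]addrC addrK.
Qed.

Lemma shift_expect_taylor2 C D f df ddf s : D.-lipschitz f ->
  (forall x : R, is_derive x 1 f (df x)) ->
  (forall x : R, is_derive x 1 df (ddf x)) -> C.-lipschitz ddf -> 0 <= C ->
  P.-integrable [set: T] (EFin \o (fun w => `|X w| ^+ 3)) ->
  `|shift_expect P X f s - f s - \int[P]_w (X w ^+ 2) / 2 * ddf s|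
    <= C * \int[P]_w (`|X w| ^+ 3).
Proof.
move=> fD fd dfd ddfC C0 int_X3.
have int_f := integrable_shift_expect s fD int_X.
have int_fs := finite_measure_integrable_cst P (f s) measurableT.
have int_df := integrableZl measurableT (df s) int_X.
have int_ddf := integrableZl measurableT (ddf s / 2) int_X2.
have int_increment := integrableB measurableT int_f int_fs.
have int_linear := integrableB measurableT int_increment int_df.
have -> : shift_expect P X f s - f s - \int[P]_w (X w ^+ 2) / 2 * ddf s =
    \int[P]_w (f (s + X w) - f s - df s * X w - ddf s / 2 * X w ^+ 2).
  rewrite RintegralB// RintegralB// RintegralB// !RintegralZl//.
  by rewrite EX Rintegral_cst_probability /shift_expect; ring.
rewrite -RintegralZl//; apply: ler_norm_Rintegral => [||w].
- exact: (integrableB measurableT int_linear int_ddf).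
- exact: (integrableZl measurableT C int_X3).
rewrite (_ : df s * X w = X w * df s); last exact: mulrC.
rewrite (_ : ddf s / 2 * X w ^+ 2 = X w ^+ 2 / 2 * ddf s); last by ring.
exact: taylor2_klipschitz.
Qed.

Lemma stein_sol_step_klipschitz1 b p h s : 0 < b -> 0 <= p -> 1.-lipschitz h ->
  \int[P]_w (X w ^+ 2) = 2 * p * b ^+ 2 ->
  P.-integrable [set: T] (EFin \o (fun w => `|X w| ^+ 3)) ->
  `|shift_expect P X (stein_sol b h) s - stein_sol b h s -
    p * shift_expect P X (stein_sol b h \- h) s|
  <= 2 / b ^+ 2 * (\int[P]_w (`|X w| ^+ 3) + p * b ^+ 2 * \int[P]_w `|X w|).
Proof.
move=> b0 p0 h1 EX2 int_X3.
set f := stein_sol b h; pose f'' := stein_sol'' b h.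
have f1 : 1.-lipschitz f by exact: klipschitz_stein_sol1.
have f''_lip : ((b ^+ 2)^-1 * (1 + 1)).-lipschitz f'' by exact: klipschitz_stein_sol''.
set K := (b ^+ 2)^-1 * (1 + 1) in f''_lip.
have K0 : 0 <= K by rewrite mulr_ge0 ?invr_ge0 ?sqr_ge0.
have taylor := shift_expect_taylor2 s f1 (is_derive_stein_sol b0 ler01 h1)
  (is_derive_stein_sol' b0 ler01 h1) f''_lip K0 int_X3.
have shift'' := klipschitz_shift_expect s f''_lip.
have fhE : shift_expect P X (f \- h) s = b ^+ 2 * shift_expect P X f'' s.
  rewrite -RintegralZl//; last exact: integrable_shift_expect f''_lip int_X.
  by apply: eq_Rintegral => w _; rewrite /= stein_sol''E.
have pb0 : 0 <= p * b ^+ 2 by rewrite mulr_ge0 ?sqr_ge0.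
rewrite fhE EX2 in taylor *.
have -> : shift_expect P X f s - f s - p * (b ^+ 2 * shift_expect P X f'' s) =
    (shift_expect P X f s - f s - 2 * p * b ^+ 2 / 2 * f'' s) -
    p * b ^+ 2 * (shift_expect P X f'' s - f'' s) by field.
apply: le_trans (ler_normB _ _) _; rewrite normrM (ger0_norm pb0).
apply: le_trans (lerD taylor (ler_wpM2l pb0 shift'')) _.
by rewrite le_eqVlt; apply/orP; left; apply/eqP; rewrite /K; ring.
Qed.

End centered_step.

HB.instance Definition _ (R : realType) :=
  @isMeasurableFun.Build _ _ _ _ (@idfun R) (@measurable_id _ R [set: R]).

Section equilibrium_distribution.
Context d (T : measurableType d) (R : realType) (P : probability T R).
Variables (X : {RV P >-> R}) (L : probability R R).
Hypothesis eqL : equilibrium_law P X L.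

Lemma equilibrium_law_scale k :
  equilibrium_law P (k \o* X) (distribution L (k \o* idfun : {RV L >-> R})).
Proof.
move=> f df ddf int_f int_ddf; set f'' := derive1 (derive1 f) in int_ddf *.
have deriv_dilate x := is_derive_dilate k x (fun y => derivable_is_derive1 (df y)).
have deriv2_dilate (x : R) : is_derive x 1 (fun y => k * derive1 f (y * k)) (k ^+ 2 * f'' (x * k)).
  have := is_deriveM (is_derive_cst k x (1 : R))
    (is_derive_dilate k x (fun y => derivable_is_derive1 (ddf y))).
  by move=> prod; apply: (is_derive_eq prod); rewrite scaler0 addr0 expr2 -mulrA.
have mf'' : measurable_fun [set: R] (EFin \o f'') by exact: measurable_int int_ddf.
have int_f'' : L.-integrable [set: R] (EFin \o (fun x => f'' (x * k))).
  apply/integrableP; split.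
    by apply: (measurableT_comp mf''); exact: measurable_funM.
  have /integrableP[_] := int_ddf.
  by rewrite ge0_integral_distribution//; exact: measurableT_comp.
have := eqL (f := fun x => f (x * k)).
rewrite (derive1_is_derive deriv_dilate) (derive1_is_derive deriv2_dilate).
move=> /(_ _ _ int_f (integrableZl measurableT (k ^+ 2) int_f'')).
rewrite mul0r => ->; last 2 first.
- by move=> x; have [] := deriv_dilate x.
- by move=> x; have [] := deriv2_dilate x.
rewrite integral_distribution//; under eq_integral do rewrite EFinM.
rewrite integralZl//.
by rewrite expectation_scale_sqr// muleACA !muleA.
Qed.

Lemma equilibrium_shift_expect v (g dg ddg : R -> R) M s :
  'E_P[fun w => (X w ^+ 2)%R] = v%:E ->
  (forall x : R, is_derive x 1 g (dg x)) ->
  (forall x : R, is_derive x 1 dg (ddg x)) ->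
  measurable_fun [set: R] ddg -> (forall x, `|g x| <= M) -> (forall x, `|ddg x| <= M) ->
  shift_expect P X g s - g s = v / 2 * shift_expect L idfun ddg s.
Proof.
move=> EX2 gd dgd mddg gM ddgM.
have deriv_g x := is_derive_translate s x gd; have deriv2_g x := is_derive_translate s x dgd.
have mg : measurable_fun [set: R] g.
  by apply: continuous_measurable_fun; exact: is_derive_continuous gd.
have m_translate u : measurable_fun [set: R] u ->
    measurable_fun [set: R] (fun x : R => u (x + s) : R).
  by move=> mu; apply: (measurableT_comp mu); exact: measurable_funD.
have int_g : P.-integrable [set: T] (EFin \o (fun w => g (X w + s))).
  apply: (integrable_bounded _ (M := M)) => // .
  exact: (measurableT_comp (m_translate _ mg)).
have int_ddg : L.-integrable [set: R] (EFin \o (fun x => ddg (x + s))).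
  by apply: (integrable_bounded _ (M := M)) => //; exact: m_translate.
have := eqL (f := fun x => g (x + s)).
rewrite (derive1_is_derive deriv_g) (derive1_is_derive deriv2_g) EX2 add0r.
have derivable_g (x : R) : derivable (fun y => g (y + s)) x 1 by have [] := deriv_g x.
have derivable_dg (x : R) : derivable (fun y => dg (y + s)) x 1 by have [] := deriv2_g x.
move=> /(_ derivable_g derivable_dg int_g int_ddg); rewrite (expectation_Rintegral int_g).
rewrite -[X in (_ * _ * X)%E]fineK; last exact: integrable_fin_num int_ddg.
rewrite -EFinB -!EFinM => identity; have {}identity := EFin_inj identity.
rewrite /shift_expect; under eq_Rintegral do rewrite addrC.
rewrite identity [2^-1 * v]mulrC; congr (_ * _).
by apply: eq_Rintegral => x _; rewrite addrC.
Qed.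

Lemma equilibrium_stein_identity b p (g dg ddg h : R -> R) M s : 0 < b ->
  'E_P[fun w => (X w ^+ 2)%R] = (2 * p * b ^+ 2)%:E ->
  (forall x : R, is_derive x 1 g (dg x)) ->
  (forall x : R, is_derive x 1 dg (ddg x)) ->
  measurable_fun [set: R] ddg -> (forall x, `|g x| <= M) -> (forall x, `|ddg x| <= M) ->
  (forall x, b ^+ 2 * ddg x = g x - h x) ->
  shift_expect P X g s - g s = p * shift_expect L idfun (g \- h) s.
Proof.
move=> b0 EX2 gd dgd mddg gM ddgM gh.
rewrite (equilibrium_shift_expect s EX2 gd dgd mddg gM ddgM).
have -> : 2 * p * b ^+ 2 / 2 = p * b ^+ 2 by field.
rewrite -mulrA -RintegralZl//; first by congr (_ * _); apply: eq_Rintegral => x _; rewrite gh.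
apply: (integrable_bounded _ (M := M)) => //.
by apply: (measurableT_comp mddg); exact: measurable_funD.
Qed.

End equilibrium_distribution.

Section kolmogorov_step.
Context d (T : measurableType d) (R : realType) (P : probability T R).
Variables (X : {RV P >-> R}) (L : probability R R) (b p e C : R) (h : R -> R).
Hypotheses (b_gt0 : 0 < b) (p_ge0 : 0 <= p).
Hypothesis EX2 : 'E_P[fun w => (X w ^+ 2)%R] = (2 * p * b ^+ 2)%:E.
Hypothesis eqL : equilibrium_law P X L.
Hypothesis quantile_le : forall u, 0 < u < 1 ->
  `|gen_inv (cdf_rv P X) u - gen_inv (cdf_law L) u| <= e.
Hypotheses (C_ge0 : 0 <= C) (h_lip : C.-lipschitz h).
Hypothesis h_itv01 : forall x, 0 <= h x <= 1.
Hypothesis h_nonincreasing : {homo h : x y /~ x <= y}.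

Let f := stein_sol b h.
Let f'' := stein_sol'' b h.
Let phi := central_diff e f.
Let psi := central_diff e h.

Let e_ge0 : 0 <= e.
Proof. by apply: le_trans (quantile_le (u := 2^-1) _); rewrite ?normr_ge0//; lra. Qed.

Let f_lip : (2 * b)^-1.-lipschitz f. Proof. exact: klipschitz_stein_sol_itv01 h_lip _. Qed.

Let f''_lip : ((b ^+ 2)^-1 * ((2 * b)^-1 + C)).-lipschitz f''.
Proof. exact: klipschitz_stein_sol'' h_lip _ f_lip. Qed.

Let f_bounded x : `|f x| <= 1.
Proof. by have /andP[f0 f1] := stein_sol_itv01 b_gt0 C_ge0 h_lip x h_itv01; rewrite ger0_norm. Qed.

Let fh_bounded x : `|(f \- h) x| <= 1.
Proof.
have := stein_sol_itv01 b_gt0 C_ge0 h_lip x h_itv01; have := h_itv01 x.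
by rewrite ler_norml /= /f; lra.
Qed.

Let f''_bounded x : `|f'' x| <= (b ^+ 2)^-1. Proof. exact: stein_sol''_bounded h_lip x _. Qed.

Let psi_bounded x : `|psi x| <= 1.
Proof.
have := h_itv01 (x - e); have := h_itv01 (x + e).
by rewrite ler_norml /psi /central_diff; lra.
Qed.

Lemma central_diff_stein_sol_le x : `|central_diff e (stein_sol b h) x| <= e / b.
Proof.
apply: le_trans (central_diff_le x e_ge0 f_lip) _.
by rewrite invfM mulrACA mulVf// mul1r mulrC.
Qed.

Let int_bounded M (g : R -> R) s : measurable_fun [set: R] g -> (forall x, `|g x| <= M) ->
  L.-integrable [set: R] (EFin \o (fun x => g (s + idfun x))).
Proof.
move=> mg gM; apply: (integrable_bounded _ (M := M)) => //.
by apply: (measurableT_comp mg); exact: measurable_funD.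
Qed.

Let step_f s : shift_expect P X f s - f s = p * shift_expect L idfun (f \- h) s.
Proof.
apply: (equilibrium_stein_identity (M := 1 + (b ^+ 2)^-1) eqL s b_gt0 EX2
  (is_derive_stein_sol b_gt0 C_ge0 h_lip) (is_derive_stein_sol' b_gt0 C_ge0 h_lip)).
- exact: klipschitz_measurable f''_lip.
- by move=> x; rewrite (le_trans (f_bounded x))// lerDl invr_ge0 sqr_ge0.
- by move=> x; rewrite (le_trans (f''_bounded x))// lerDr.
- by move=> x; exact: stein_sol''E.
Qed.

Let step_phi s : shift_expect P X phi s - phi s =
  p * (shift_expect L idfun phi s - shift_expect L idfun psi s).
Proof.
have dphi x := is_derive_central_diff e x (is_derive_stein_sol b_gt0 C_ge0 h_lip).
have dphi' x := is_derive_central_diff e x (is_derive_stein_sol' b_gt0 C_ge0 h_lip).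
have m_phi'' := klipschitz_measurable (klipschitz_central_diff e f''_lip).
rewrite (equilibrium_stein_identity (h := psi) (M := e / b + ((b ^+ 2)^-1 + (b ^+ 2)^-1))
  eqL s b_gt0 EX2 dphi dphi' m_phi'').
- rewrite [shift_expect L _ (_ \- _) s]RintegralB//.
    exact: int_bounded (klipschitz_measurable (klipschitz_central_diff e f_lip))
      central_diff_stein_sol_le.
  exact: int_bounded (klipschitz_measurable (klipschitz_central_diff e h_lip)) psi_bounded.
- move=> x; rewrite (le_trans (central_diff_stein_sol_le x))//.
  by rewrite lerDl addr_ge0// invr_ge0 sqr_ge0.
- move=> x; apply: le_trans (central_diff_bounded e x f''_bounded) _.
  by rewrite lerDr divr_ge0// ltW.
- by move=> x; rewrite /psi /central_diff mulrBr !stein_sol''E//; ring.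
Qed.

Let osc x := e / (2 * b) + psi x.

Let osc_le x y : `|x - y| <= e -> `|(f \- h) x - (f \- h) y| <= osc y.
Proof.
move=> xy; have -> : (f \- h) x - (f \- h) y = (f x - f y) - (h x - h y) by rewrite /=; ring.
apply: le_trans (ler_normB _ _) _; apply: lerD.
  have /klipschitzP f_xy := f_lip; apply: le_trans (f_xy x y) _; rewrite mulrC.
  by rewrite ler_wpM2r// invr_ge0 mulr_ge0// ltW.
exact: nonincreasing_central_diff h_nonincreasing xy.
Qed.

Let coupling s : `|shift_expect P X (f \- h) s - shift_expect L idfun (f \- h) s|
  <= e / (2 * b) + shift_expect L idfun psi s.
Proof.
have m_psi := klipschitz_measurable (klipschitz_central_diff e h_lip).
have eb0 : 0 <= e / (2 * b) by rewrite divr_ge0// mulr_ge0// ltW.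
rewrite -(Rintegral_cst_probability L (e / (2 * b))) -RintegralD//; last 2 first.
- exact: finite_measure_integrable_cst.
- exact: int_bounded m_psi psi_bounded.
apply: (quantile_coupling (Z := idfun : {RV L >-> R}) (g := fun x => (f \- h) (s + x))
  (osc := fun x => osc (s + x)) (M := e / (2 * b) + 1) quantile_le).
- apply: (measurableT_comp (klipschitz_measurable (klipschitzB f_lip h_lip))).
  exact: measurable_funD.
- by apply: measurable_funD => //; apply: (measurableT_comp m_psi); exact: measurable_funD.
- by move=> x; rewrite (le_trans (fh_bounded _))// lerDr.
- by move=> x; rewrite (le_trans (ler_normD _ _))// lerD// ger0_norm.
- by move=> x y xy; apply: osc_le; rewrite opprD addrACA subrr add0r.
Qed.

Lemma stein_sol_step_itv01 s :
  `|shift_expect P X f s - f s - p * shift_expect P X (f \- h) s|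
  <= p * (3 * e / (2 * b)) - (shift_expect P X phi s - phi s).
Proof.
have phi_L : shift_expect L idfun phi s <= e / b.
  apply: le_trans (ler_norm _) _.
  apply: normr_Rintegral_bounded => [|x]; last exact: central_diff_stein_sol_le.
  apply: (measurableT_comp (klipschitz_measurable (klipschitz_central_diff e f_lip))).
  exact: measurable_funD.
rewrite step_f step_phi -!mulrBr normrM (ger0_norm p_ge0) distrC ler_wpM2l//.
apply: le_trans (coupling s) _.
have -> : 3 * e / (2 * b) = e / (2 * b) + e / b by field; rewrite gt_eqF.
lra.
Qed.

End kolmogorov_step.

(** * Upper bounds *)

Section random_psum_bounds.
Context d (T : measurableType d) (R : realType) (P : probability T R).
Variables (X : nat -> {RV P >-> R}) (N : T -> nat) (p s b : R).
Hypothesis p01 : 0 < p < 1.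
Hypothesis geoN : geometric_rv P N p.
Hypothesis indX : mutually_independent P (steps_and_index X N).
Hypotheses (s_gt0 : 0 < s) (b_gt0 : 0 < b) (sqr_s : s ^+ 2 = 2 * p * b ^+ 2).
Hypothesis EX : forall i, 'E_P[X i] = 0%E.
Hypothesis EX2 : forall i, 'E_P[fun w => (X i w ^+ 2)%R] = (s ^+ 2)%:E.

Let p_gt0 : 0 < p. Proof. by case/andP: p01. Qed.

Let int_X2 i : P.-integrable [set: T] (EFin \o (fun w => X i w ^+ 2)).
Proof.
apply: ge0_integrable_expectation => [|w|]; last by rewrite EX2 ltry.
- exact: measurable_funX.
- exact: sqr_ge0.
Qed.

Let int_X i : P.-integrable [set: T] (EFin \o X i).
Proof. exact: integrable_of_sqr (int_X2 i). Qed.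

Let Rintegral_X i : \int[P]_w X i w = 0.
Proof. by apply: EFin_inj; rewrite -expectation_Rintegral ?EX. Qed.

Let Rintegral_X2 i : \int[P]_w (X i w ^+ 2) = s ^+ 2.
Proof. by apply: EFin_inj; rewrite -expectation_Rintegral ?EX2. Qed.

Let norm_X i : \int[P]_w `|X i w| <= s.
Proof. by apply: Rintegral_norm_le_sqrt => //; rewrite Rintegral_X2. Qed.

Lemma integrable_klipschitz_random_psum C h : C.-lipschitz h ->
  P.-integrable [set: T] (EFin \o (h \o random_psum X N)).
Proof.
by move=> hC; exact: klipschitz_integrable hC (integrable_random_psum p01 geoN indX int_X norm_X).
Qed.

Lemma random_psum_klipschitz1_bound h rho : 1.-lipschitz h ->
  (forall i, P.-integrable [set: T] (EFin \o (fun w => `|X i w| ^+ 3))) ->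
  (forall i, \int[P]_w (`|X i w| ^+ 3) <= rho) ->
  `|\int[P]_w h (random_psum X N w) - stein_sol b h 0|
    <= 2 / b ^+ 2 * (rho / p + b ^+ 2 * s).
Proof.
move=> h1 int_X3 X3_le.
have zero_lip : 0.-lipschitz (cst 0 : R -> R).
  by apply/klipschitzP => x y; rewrite subrr normr0 mul0r.
have := random_psum_stein_bound (E := 2 / b ^+ 2 * (rho / p + b ^+ 2 * s)) p01 geoN indX
  int_X norm_X (klipschitz_stein_sol1 b_gt0 h1) h1 zero_lip.
rewrite Rintegral_cst_probability !subr0; apply => j x.
rewrite [shift_expect _ _ (cst 0) _]Rintegral_cst_probability !subr0.
apply: le_trans (stein_sol_step_klipschitz1 _ _ _ _ _ _ _ _) _ => //.
- exact: ltW.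
- by rewrite Rintegral_X2.
have -> : p * (2 / b ^+ 2 * (rho / p + b ^+ 2 * s)) = 2 / b ^+ 2 * (rho + p * b ^+ 2 * s).
  by field; rewrite (gt_eqF b_gt0) (gt_eqF p_gt0).
rewrite ler_wpM2l ?divr_ge0 ?sqr_ge0// lerD// ler_wpM2l//.
by rewrite mulr_ge0 ?sqr_ge0// ltW.
Qed.

Lemma random_psum_itv01_bound (L : nat -> probability R R) (e C : R) (h : R -> R) :
  (forall i, equilibrium_law P (X i) (L i)) ->
  (forall i u, 0 < u < 1 ->
    `|gen_inv (cdf_rv P (X i)) u - gen_inv (cdf_law (L i)) u| <= e) ->
  0 <= C -> C.-lipschitz h -> (forall x, 0 <= h x <= 1) -> {homo h : x y /~ x <= y} ->
  `|\int[P]_w h (random_psum X N w) - stein_sol b h 0| <= 7 * e / (2 * b).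
Proof.
move=> eqL quantile_le C0 hC h01 h_ni.
have f_lip := klipschitz_stein_sol_itv01 b_gt0 C0 hC h01.
set f := stein_sol b h in f_lip *; pose phi := central_diff e f.
have phi_lip := klipschitz_central_diff e f_lip.
have EX2b i : 'E_P[fun w => (X i w ^+ 2)%R] = (2 * p * b ^+ 2)%:E by rewrite EX2 sqr_s.
have stein_le := random_psum_stein_bound p01 geoN indX int_X norm_X f_lip hC phi_lip
  (fun j x => stein_sol_step_itv01 b_gt0 (ltW p_gt0) (EX2b j) (@eqL j) (quantile_le j)
    C0 hC h01 h_ni x).
have phi_le x : `|phi x| <= e / b.
  exact: central_diff_stein_sol_le b_gt0 (quantile_le 0%N) C0 hC h01 x.
have Ephi_le : `|\int[P]_w phi (random_psum X N w)| <= e / b.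
  apply: normr_Rintegral_bounded => [|w]; last exact: phi_le.
  apply: (measurableT_comp (klipschitz_measurable phi_lip)).
  exact: measurable_random_psum geoN.1.
apply: le_trans stein_le _.
have -> : 7 * e / (2 * b) = 3 * e / (2 * b) + 2 * (e / b) by field; rewrite gt_eqF.
rewrite lerD2l lerNl; have := phi_le 0; move: Ephi_le; rewrite !ler_norml -/(phi _).
by move: (e / b) (phi 0) (\int[P]_w _) => u v w; lra.
Qed.

End random_psum_bounds.

Section ramp.
Context {R : realType}.
Variables x e : R.
Hypothesis e_gt0 : 0 < e.
Implicit Types y z : R.

Definition ramp y : R := Num.max 0 (Num.min 1 ((x + e - y) / e)).

Lemma ramp_itv01 y : 0 <= ramp y <= 1.
Proof. by rewrite le_max lexx/= ge_max ler01 ge_min lexx. Qed.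

Lemma ramp_nonincreasing : {homo ramp : y z /~ y <= z}.
Proof.
move=> y z yz; rewrite /ramp; apply: le_max2 => //; apply: le_min2 => //.
by rewrite ler_pM2r ?invr_gt0// lerD2l lerN2.
Qed.

Lemma ramp_eq1 y : y <= x -> ramp y = 1.
Proof.
move=> yx; have ge1 : 1 <= (x + e - y) / e by rewrite ler_pdivlMr// mul1r; lra.
by rewrite /ramp (min_idPl ge1); apply/max_idPr.
Qed.

Lemma ramp_eq0 y : x + e <= y -> ramp y = 0.
Proof.
move=> yx; have le0 : (x + e - y) / e <= 0 by rewrite ler_pdivrMr// mul0r; lra.
by apply/max_idPl; rewrite ge_min le0 orbT.
Qed.

Lemma klipschitz_ramp : e^-1.-lipschitz ramp.
Proof.
have clamp (u v : R) : `|Num.max 0 (Num.min 1 u) - Num.max 0 (Num.min 1 v)| <= `|u - v|.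
  wlog uv : u v / u <= v.
    by move=> le_clamp; have [/le_clamp//|/ltW/le_clamp] := leP u v; rewrite distrC (distrC v u).
  rewrite [leRHS]distrC [leLHS]distrC [leRHS]ger0_norm ?subr_ge0// ger0_norm.
    by rewrite /Num.max /Num.min; repeat case: ifPn; rewrite -?leNgt; lra.
  by rewrite subr_ge0; apply: le_max2 => //; apply: le_min2.
apply/klipschitzP => y z; apply: le_trans (clamp _ _) _.
have -> : (x + e - y) / e - (x + e - z) / e = - (e^-1 * (y - z)) by ring.
by rewrite normrN normrM ger0_norm// invr_ge0 ltW.
Qed.

End ramp.

Lemma cdf_rv_ramp d (T : measurableType d) (R : realType) (P : probability T R)
    (W : T -> R) (x e : R) : measurable_fun [set: T] W -> 0 < e ->
  cdf_rv P W x <= \int[P]_w ramp x e (W w) <= cdf_rv P W (x + e).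
Proof.
move=> mW e0.
have int_ind y : P.-integrable [set: T] (EFin \o \1_[set w | W w <= y]).
  exact: (integrable_indic P (measurable_sublevel y mW)).
have int_ramp : P.-integrable [set: T] (EFin \o (fun w => ramp x e (W w))).
  apply: (integrable_bounded _ (M := 1)) => [|w].
    by apply: (measurableT_comp _ mW); exact: klipschitz_measurable (klipschitz_ramp x e0).
  by rewrite ger0_norm; case/andP: (ramp_itv01 x e (W w)).
have cdfE y : cdf_rv P W y = \int[P]_w \1_[set w | W w <= y] w.
  by rewrite /cdf_rv /Rintegral integral_indic ?setIT//; exact: measurable_sublevel.
rewrite !cdfE; apply/andP; split; apply: le_Rintegral => // w _; rewrite indicE.
- case: (boolP (w \in _)) => [/set_mem/= Wx|_]; first by rewrite ramp_eq1.
  by case/andP: (ramp_itv01 x e (W w)).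
- case: (boolP (w \in _)) => [_|/negP]; first by case/andP: (ramp_itv01 x e (W w)).
  by rewrite inE/= => /negP; rewrite -ltNge => /ltW Wx; rewrite ramp_eq0.
Qed.

Section laplace_cdf.
Context {R : realType}.
Variable b : R.
Hypothesis b_gt0 : 0 < b.
Notation mu := (@lebesgue_measure R).

Let m_pdf (A : set (measurableTypeR R)) : measurable A ->
  measurable_fun A (fun y => (laplace_pdf b y)%:E).
Proof.
by move=> mA; apply/measurable_EFinP/measurable_funTS; exact: measurable_laplace_pdf.
Qed.

Lemma laplace_cdf_add (x e : R) : 0 < e ->
  (laplace_cdf b (x + e) <= laplace_cdf b x + (e / (2 * b))%:E)%E.
Proof.
move=> e0; rewrite /laplace_cdf.
have -> : `]-oo, (x + e)%R]%classic = `]-oo, x] `|` `]x, (x + e)%R].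
  by rewrite -itv_bndbnd_setU// bnd_simp ltW// ltrDl.
rewrite ge0_integral_setU//; last 3 first.
- by apply: m_pdf; exact: measurableU.
- by move=> y _; rewrite lee_fin laplace_pdf_ge0.
- by apply/disj_setPS => y /=; rewrite !in_itv/= => -[yx /andP[xy _]]; lra.
rewrite leeD2l//.
apply: (@le_trans _ _ (\int[mu]_(y in `]x, (x + e)%R]) ((2 * b)^-1)%:E)%E).
  apply: ge0_le_integral => //.
  - by move=> y _; rewrite lee_fin laplace_pdf_ge0.
  - exact: m_pdf.
  - by move=> y _; rewrite lee_fin laplace_pdf_le.
rewrite integral_cst//= lebesgue_measure_itv/= lte_fin ltrDl e0.
by rewrite -EFinD -EFinM lee_fin addrAC subrr add0r mulrC.
Qed.

Lemma laplace_cdf_ramp (x e : R) : 0 < e ->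
  (laplace_cdf b x <= laplace_expect b (ramp x e) <= laplace_cdf b (x + e))%E.
Proof.
move=> e0; have m_ramp := klipschitz_measurable (klipschitz_ramp x e0).
have m_ramp_pdf : measurable_fun [set: measurableTypeR R]
    (fun y => (ramp x e y * laplace_pdf b y)%:E).
  by apply/measurable_EFinP/measurable_funM => //; exact: measurable_laplace_pdf.
have ramp_pdf_ge0 y : (0 <= (ramp x e y * laplace_pdf b y)%:E)%E.
  by rewrite lee_fin mulr_ge0 ?laplace_pdf_ge0//; case/andP: (ramp_itv01 x e y).
have m_itv (z : R) : @measurable _ (measurableTypeR R) `]-oo, z] by [].
rewrite /laplace_cdf /laplace_expect; apply/andP; split.
- rewrite integral_mkcond; apply: ge0_le_integral => //.
  + by move=> y _; rewrite patchE; case: ifPn => //; rewrite lee_fin laplace_pdf_ge0.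
  + by apply/(measurable_restrictT _ (m_itv _)); exact: m_pdf.
  + move=> y _; rewrite patchE; case: ifPn => // /set_mem /=.
    by rewrite in_itv/= => yx; rewrite ramp_eq1// mul1r.
- rewrite [leRHS]integral_mkcond; apply: ge0_le_integral => //.
  + by apply/(measurable_restrictT _ (m_itv _)); exact: m_pdf.
  + move=> y _; rewrite patchE; case: ifPn => [_|/negP].
      by rewrite lee_fin ler_piMl ?laplace_pdf_ge0//; case/andP: (ramp_itv01 x e y).
    rewrite inE/= in_itv/= => /negP; rewrite -ltNge => /ltW yx.
    by rewrite ramp_eq0// mul0r.
Qed.

Let laplace_expect_ramp (x e : R) : 0 < e ->
  laplace_expect b (ramp x e) = (stein_sol b (ramp x e) 0)%:E.
Proof.
move=> e0; apply: laplace_expect_stein_sol (klipschitz_ramp x e0) => //.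
by rewrite invr_ge0 ltW.
Qed.

Lemma laplace_cdf_fin_num x : laplace_cdf b x \is a fin_num.
Proof.
rewrite ge0_fin_numE; last first.
  by apply: integral_ge0 => y _; rewrite lee_fin laplace_pdf_ge0.
have /andP[] := laplace_cdf_ramp x ltr01.
by rewrite laplace_expect_ramp// => /le_lt_trans + _; apply; exact: ltry.
Qed.

Lemma dK_laplace_le_ramp d (T : measurableType d) (P : probability T R) (W : T -> R) (E : R) :
  measurable_fun [set: T] W ->
  (forall x e : R, 0 < e ->
    `|\int[P]_w ramp x e (W w) - stein_sol b (ramp x e) 0| <= E) ->
  (dK_laplace P W b <= E%:E)%E.
Proof.
move=> mW ramp_le; apply: ge_ereal_sup => _ [x _ <-].
apply/lee_addgt0Pr => e' e'0; pose e := e' * (2 * b).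
have e0 : 0 < e by rewrite !mulr_gt0.
pose F y := fine (laplace_cdf b y).
have FE y : laplace_cdf b y = (F y)%:E by rewrite fineK// laplace_cdf_fin_num.
have F_ramp y : F y <= stein_sol b (ramp y e) 0 <= F (y + e).
  by have := laplace_cdf_ramp y e0; rewrite laplace_expect_ramp// !FE !lee_fin.
have F_add y : F (y + e) <= F y + e'.
  have := laplace_cdf_add y e0; rewrite !FE -EFinD lee_fin /e mulfK//.
  by rewrite gt_eqF// mulr_gt0.
have G_ramp y := cdf_rv_ramp P y mW e0.
have -> : P [set w | W w <= x] = (cdf_rv P W x)%:E.
  by rewrite /cdf_rv fineK// fin_num_measure//; exact: measurable_sublevel.
rewrite FE -EFinB -EFinD lee_fin ler_norml.
have := G_ramp x; have := G_ramp (x - e); have := F_ramp x; have := F_ramp (x - e).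
have := F_add x; have := F_add (x - e); rewrite !subrK.
have := ramp_le x e e0; have := ramp_le (x - e) e e0; rewrite !ler_norml.
lra.
Qed.

End laplace_cdf.

Section wasserstein_distance.
Context d (T : measurableType d) (R : realType) (P : probability T R).
Variables (W : T -> R) (b : R).
Hypothesis b_gt0 : 0 < b.

Lemma lipschitz1P (h : R -> R) : lipschitz1 h <-> 1.-lipschitz h.
Proof. by rewrite klipschitzP; split=> h1 x y; have := h1 x y; rewrite mul1r. Qed.

Let discrepancyE (h : R -> R) : 1.-lipschitz h ->
  P.-integrable [set: T] (EFin \o (h \o W)) ->
  (`|'E_P[h \o W] - laplace_expect b h|)%E =
  (`|\int[P]_w h (W w) - stein_sol b h 0|)%:E.
Proof.
move=> h1 int_hW; rewrite expectation_Rintegral//.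
by rewrite (laplace_expect_stein_sol b_gt0 ler01 h1).
Qed.

Lemma dW_laplace_le_test E :
  (forall h : R -> R, 1.-lipschitz h -> P.-integrable [set: T] (EFin \o (h \o W))) ->
  (forall h : R -> R, 1.-lipschitz h -> `|\int[P]_w h (W w) - stein_sol b h 0| <= E) ->
  (dW_laplace P W b <= E%:E)%E.
Proof.
move=> int_W test_le; apply: ge_ereal_sup => _ [h /lipschitz1P h1 <-].
by rewrite discrepancyE ?lee_fin ?test_le//; exact: int_W.
Qed.

Lemma dW_laplace_ge_test (h : R -> R) : 1.-lipschitz h ->
  P.-integrable [set: T] (EFin \o (h \o W)) ->
  ((`|\int[P]_w h (W w) - stein_sol b h 0|)%:E <= dW_laplace P W b)%E.
Proof.
move=> h1 int_hW; rewrite -discrepancyE//; apply: ereal_sup_ubound.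
by exists h => //; exact/lipschitz1P.
Qed.

End wasserstein_distance.

Section scaled_steps.
Context d (T : measurableType d) (R : realType) (P : probability T R).
Variables (X : nat -> {RV P >-> R}) (N : T -> nat) (k : R).

Definition scaled_steps i : {RV P >-> R} := k \o* X i.

Lemma mutually_independent_scaled_steps :
  mutually_independent P (steps_and_index X N) ->
  mutually_independent P (steps_and_index scaled_steps N).
Proof.
pose g (o : option nat) (x : R) := if o is Some _ then x * k else x.
have mg o : measurable_fun [set: R] (g o).
  by rewrite /g; case: o => [i|]; [exact: measurable_funM|exact: measurable_id].
move=> /(mutually_independent_comp mg); congr (mutually_independent P _).
by apply/funext => -[].
Qed.

End scaled_steps.

Lemma random_sumE d (T : measurableType d) (R : realType) (P : probability T R)
    (X : nat -> {RV P >-> R}) (N : T -> nat) (p : R) :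
  random_sum (fun i => X i : T -> R) N p = random_psum (scaled_steps X (Num.sqrt p)) N.
Proof.
by apply/funext => w; rewrite /random_sum mulr_sumr; apply: eq_bigr => i _; rewrite mulrC.
Qed.

Section laplace_approximation.
Context d (T : measurableType d) (R : realType) (P : probability T R).
Variables (X : nat -> {RV P >-> R}) (sigma p : R) (N : T -> nat).
Hypotheses (sigma_gt0 : 0 < sigma) (p01 : 0 < p < 1).
Hypothesis EX : forall i, 'E_P[X i] = 0%E.
Hypothesis EX2 : forall i, 'E_P[fun w => (X i w ^+ 2)%R] = (sigma ^+ 2)%:E.
Hypothesis geoN : geometric_rv P N p.
Hypothesis indX : mutually_independent P (steps_and_index X N).

Let k := Num.sqrt p.
Let b := sigma / Num.sqrt 2.
Let s := sigma * k.
Let Y := scaled_steps X k.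

Let p_gt0 : 0 < p. Proof. by case/andP: p01. Qed.
Let k_gt0 : 0 < k. Proof. by rewrite sqrtr_gt0. Qed.
Let sqr_k : k ^+ 2 = p. Proof. by rewrite sqr_sqrtr// ltW. Qed.
Let b_gt0 : 0 < b. Proof. by rewrite divr_gt0// sqrtr_gt0. Qed.
Let sqr_b : b ^+ 2 = sigma ^+ 2 / 2. Proof. by rewrite exprMn exprVn sqr_sqrtr. Qed.
Let s_gt0 : 0 < s. Proof. exact: mulr_gt0. Qed.
Let sqr_s : s ^+ 2 = 2 * p * b ^+ 2. Proof. by rewrite exprMn sqr_k sqr_b; field. Qed.

Let indY : mutually_independent P (steps_and_index Y N).
Proof. exact: mutually_independent_scaled_steps. Qed.

Let EY2 i : 'E_P[fun w => (Y i w ^+ 2)%R] = (s ^+ 2)%:E.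
Proof. by rewrite expectation_scale_sqr// EX2 -EFinM -exprMn mulrC. Qed.

Let EY i : 'E_P[Y i] = 0%E.
Proof.
rewrite expectationZl ?EX ?mule0//; apply/Lfun1_integrable.
apply: integrable_of_sqr => //; apply: ge0_integrable_expectation => [|w|].
- exact: measurable_funX.
- exact: sqr_ge0.
- by rewrite EX2 ltry.
Qed.

Let int_W C (h : R -> R) : C.-lipschitz h ->
  P.-integrable [set: T] (EFin \o (h \o random_psum Y N)).
Proof. exact: integrable_klipschitz_random_psum p01 geoN indY s_gt0 EY2 _ _. Qed.

Lemma dW_laplace_random_sum_le :
  let rho := ereal_sup (range (fun i => 'E_P[fun w => (`|X i w| ^+ 3)%R])) in
  (rho < +oo)%E ->
  (dW_laplace P (random_sum (fun i => X i : T -> R) N p) b <=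
    (12 * Num.sqrt p)%:E * (sigma%:E + rho * ((3 * sigma ^+ 2)^-1)%:E))%E.
Proof.
move=> rho rho_lty; rewrite random_sumE.
have X3_le i : ('E_P[fun w => (`|X i w| ^+ 3)%R] <= rho)%E.
  by apply: ereal_sup_ubound; exists i.
have rho_ge0 : (0 <= rho)%E.
  by apply: le_trans (X3_le 0%N); apply: expectation_ge0 => w; exact: exprn_ge0.
have rho_fin : rho \is a fin_num by rewrite ge0_fin_numE.
have int_X3 i : P.-integrable [set: T] (EFin \o (fun w => `|X i w| ^+ 3)).
  apply: ge0_integrable_expectation => [|w|]; last exact: le_lt_trans (X3_le i) rho_lty.
  - by apply: measurable_funX; exact: measurableT_comp.
  - exact: exprn_ge0.
have Y3E i w : `|Y i w| ^+ 3 = k ^+ 3 * `|X i w| ^+ 3.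
  by rewrite normrM (gtr0_norm k_gt0) exprMn mulrC.
apply: (@le_trans _ _ (2 / b ^+ 2 * (k ^+ 3 * fine rho / p + b ^+ 2 * s))%:E).
  apply: dW_laplace_le_test => // [h|h h1]; first exact: int_W.
  apply: (random_psum_klipschitz1_bound p01 geoN indY s_gt0 b_gt0 sqr_s EY EY2 h1) => i.
    by under eq_fun do rewrite Y3E; exact: (integrableZl measurableT _ (int_X3 i)).
  under eq_Rintegral do rewrite Y3E.
  rewrite RintegralZl// ler_wpM2l ?exprn_ge0 ?(ltW k_gt0)//.
  by have := X3_le i; rewrite expectation_Rintegral// -[rho]fineK// lee_fin.
rewrite -[X in (_ + X * _)%E](fineK rho_fin) -EFinM lee_fin.
have fine_rho_ge0 : 0 <= fine rho by rewrite fine_ge0.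
have sigma_neq0 : sigma != 0 by rewrite gt_eqF.
have -> : 2 / b ^+ 2 * (k ^+ 3 * fine rho / p + b ^+ 2 * s) =
    k * (4 * fine rho / sigma ^+ 2 + 2 * sigma).
  by rewrite sqr_b -sqr_k /s; field; rewrite sigma_neq0 gt_eqF.
have -> : 12 * Num.sqrt p * (sigma + fine rho / (3 * sigma ^+ 2)) =
    k * (4 * fine rho / sigma ^+ 2 + 12 * sigma) by rewrite -/k; field.
by rewrite ler_pM2l// lerD2l ler_pM2r// ler_nat.
Qed.

Lemma dK_laplace_random_sum_le_quantile_gap (L : nat -> probability R R) B :
  (forall i, equilibrium_law P (X i) (L i)) ->
  (forall i u, 0 < u < 1 ->
    `|gen_inv (cdf_rv P (X i)) u - gen_inv (cdf_law (L i)) u| <= B) ->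
  (dK_laplace P (random_sum (fun i => X i : T -> R) N p) b <= (7 * (B * k) / (2 * b))%:E)%E.
Proof.
move=> eqL quantile_le; rewrite random_sumE.
have eqY i := equilibrium_law_scale (eqL i) (k := k).
have quantileY_le i u : 0 < u < 1 ->
    `|gen_inv (cdf_rv P (Y i)) u -
      gen_inv (cdf_law (distribution (L i) (k \o* idfun : {RV (L i) >-> R}))) u| <= B * k.
  move=> u01; rewrite (gen_inv_cdf_rv_scale (X i))//.
  rewrite (gen_inv_cdf_rv_scale (idfun : {RV (L i) >-> R}))//.
  by rewrite -mulrBl normrM (gtr0_norm k_gt0) ler_wpM2r ?quantile_le// ltW.
apply: dK_laplace_le_ramp => // [|x e e0]; first exact: measurable_random_psum geoN.1.
apply: (random_psum_itv01_bound p01 geoN indY s_gt0 b_gt0 sqr_s EY2 eqY quantileY_le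
  _ (klipschitz_ramp x e0)) => //.
- by rewrite invr_ge0 ltW.
- exact: ramp_itv01.
- exact: ramp_nonincreasing.
Qed.

Lemma dK_laplace_random_sum_le (L : nat -> probability R R) :
  (forall i, equilibrium_law P (X i) (L i)) ->
  (dK_laplace P (random_sum (fun i => X i : T -> R) N p) b <=
     (1704 / 100 * Num.sqrt p / sigma)%:E *
     ereal_sup [set e | exists (i : nat) (u : R), (0 < u < 1)%R /\
       e = (`|gen_inv (cdf_rv P (X i)) u - gen_inv (cdf_law (L i)) u|)%:E])%E.
Proof.
move=> eqL; have : 6 <= 1704 / 100 :> R by lra.
(* Unification would unfold the numeral [1704]. *)
move: (1704 / 100) => c c_ge6; set S := [set e | _].
have c_gt0 : 0 < c by exact: lt_le_trans c_ge6.
have S_le i u : 0 < u < 1 ->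
    ((`|gen_inv (cdf_rv P (X i)) u - gen_inv (cdf_law (L i)) u|)%:E <= ereal_sup S)%E.
  by move=> u01; apply: ereal_sup_ubound; exists i, u.
have S_ge0 : (0 <= ereal_sup S)%E.
  by apply: le_trans (S_le 0%N 2^-1 _); rewrite ?lee_fin ?normr_ge0//; lra.
have [->|S_neqy] := eqVneq (ereal_sup S) +oo%E.
  by rewrite gt0_muley ?leey// lte_fin !mulr_gt0 ?invr_gt0.
have S_fin : ereal_sup S \is a fin_num by rewrite ge0_fin_numE// ltey.
apply: le_trans (dK_laplace_random_sum_le_quantile_gap (B := fine (ereal_sup S)) eqL _) _.
  by move=> i u u01; rewrite -lee_fin fineK// S_le.
rewrite -[X in (_ * X)%E](fineK S_fin) -EFinM lee_fin.
have sqrt2_le : Num.sqrt 2 <= 3 / 2 :> R.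
  by rewrite -[leRHS]ger0_norm// -sqrtr_sqr ler_sqrt; lra.
have sqrt2_neq0 : Num.sqrt 2 != 0 :> R by rewrite gt_eqF// sqrtr_gt0.
have -> : 7 * (fine (ereal_sup S) * k) / (2 * b) =
    7 / 2 * Num.sqrt 2 * (k / sigma * fine (ereal_sup S)).
  by rewrite /b; field; rewrite sqrt2_neq0 gt_eqF.
have -> : c * Num.sqrt p / sigma * fine (ereal_sup S) = c * (k / sigma * fine (ereal_sup S)).
  by rewrite -/k; ring.
apply: ler_wpM2r; last lra.
by rewrite mulr_ge0 ?fine_ge0// divr_ge0// ltW.
Qed.

End laplace_approximation.

(** * Lower bound *)

Section sin_cos_bounds.
Context {R : realType}.
Implicit Types x : R.

Lemma ge0_of_derive_ge0 (g dg : R -> R) x :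
  (forall y : R, is_derive y 1 g (dg y)) -> g 0 = 0 ->
  (forall y, 0 <= y -> 0 <= dg y) -> 0 <= x -> 0 <= g x.
Proof.
move=> gd g0 dg0 x0.
have [|z] := @MVT_segment _ g dg 0 x x0 (fun z _ => gd z).
  by apply: continuous_subspaceT; exact: is_derive_continuous gd.
by rewrite in_itv/= g0 !subr0 => /andP[z0 _] ->; rewrite mulr_ge0// dg0.
Qed.

Let sin_le_taylor1 x : 0 <= x -> 0 <= x - sin x.
Proof.
apply: (@ge0_of_derive_ge0 (fun x => x - sin x) (fun x => 1 - cos x)).
- by rewrite sin0 subr0.
- by move=> y _; rewrite subr_ge0 cos_le1.
Qed.

Let cos_ge_taylor2 x : 0 <= x -> 0 <= cos x - 1 + 2^-1 * x ^+ 2.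
Proof.
apply: (@ge0_of_derive_ge0 (fun x => cos x - 1 + 2^-1 * x ^+ 2) (fun x => x - sin x)).
- by move=> y; apply: is_derive_eq; rewrite /GRing.scale/=; field.
- by rewrite cos0 subrr expr0n/= mulr0 addr0.
- exact: sin_le_taylor1.
Qed.

Let sin_ge_taylor3 x : 0 <= x -> 0 <= sin x - x + 6^-1 * x ^+ 3.
Proof.
apply: (@ge0_of_derive_ge0 (fun x => sin x - x + 6^-1 * x ^+ 3)
  (fun x => cos x - 1 + 2^-1 * x ^+ 2)).
- by move=> y; apply: is_derive_eq; rewrite /GRing.scale/=; field.
- by rewrite sin0 subrr expr0n/= mulr0 addr0.
- exact: cos_ge_taylor2.
Qed.

Let cos_le_taylor4 x : 0 <= x -> 0 <= 1 - 2^-1 * x ^+ 2 + 24^-1 * x ^+ 4 - cos x.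
Proof.
apply: (@ge0_of_derive_ge0 (fun x => 1 - 2^-1 * x ^+ 2 + 24^-1 * x ^+ 4 - cos x)
  (fun x => sin x - x + 6^-1 * x ^+ 3)).
- by move=> y; apply: is_derive_eq; rewrite /GRing.scale/=; field.
- by rewrite cos0 !expr0n/= !mulr0 subr0 addr0 subrr.
- exact: sin_ge_taylor3.
Qed.

Let sin_le_taylor5 x : 0 <= x -> 0 <= x - 6^-1 * x ^+ 3 + 120^-1 * x ^+ 5 - sin x.
Proof.
apply: (@ge0_of_derive_ge0 (fun x => x - 6^-1 * x ^+ 3 + 120^-1 * x ^+ 5 - sin x)
  (fun x => 1 - 2^-1 * x ^+ 2 + 24^-1 * x ^+ 4 - cos x)).
- by move=> y; apply: is_derive_eq; rewrite /GRing.scale/=; field.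
- by rewrite sin0 !expr0n/= !mulr0 subr0 addr0 subrr.
- exact: cos_le_taylor4.
Qed.

Lemma cos_ge_quadratic x : 1 - 2^-1 * x ^+ 2 <= cos x.
Proof.
have [x0|/ltW x0] := leP 0 x; first by have := cos_ge_taylor2 x0; lra.
by have := @cos_ge_taylor2 (- x); rewrite oppr_ge0 cosN sqrrN => /(_ x0); lra.
Qed.

Lemma sin_taylor1 x : `|sin x - x| <= 6^-1 * `|x| ^+ 3.
Proof.
wlog x0 : x / 0 <= x.
  move=> taylor; have [/taylor//|/ltW x0] := leP 0 x.
  have := taylor (- x); rewrite oppr_ge0 sinN normrN => /(_ x0).
  by rewrite -opprD normrN.
rewrite (ger0_norm x0) ler_norml; have := exprn_ge0 3 x0.
by have := sin_le_taylor1 x0; have := sin_ge_taylor3 x0; lra.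
Qed.

Lemma sin_taylor3 x : `|sin x - x + 6^-1 * x ^+ 3| <= 120^-1 * `|x| ^+ 5.
Proof.
wlog x0 : x / 0 <= x.
  move=> taylor; have [/taylor//|/ltW x0] := leP 0 x.
  have := taylor (- x); rewrite oppr_ge0 sinN normrN => /(_ x0).
  have -> : - sin x - - x + 6^-1 * (- x) ^+ 3 = - (sin x - x + 6^-1 * x ^+ 3) by ring.
  by rewrite normrN.
rewrite (ger0_norm x0) ler_norml; have := exprn_ge0 5 x0.
by have := sin_ge_taylor3 x0; have := sin_le_taylor5 x0; lra.
Qed.

Lemma klipschitz_sin : 1.-lipschitz (@sin R).
Proof. by apply: (@is_derive_klipschitz _ 1 sin cos) => x; exact: cos_max. Qed.

Lemma klipschitz_cos : 1.-lipschitz (@cos R).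
Proof.
apply: (@is_derive_klipschitz _ 1 cos (fun x => - sin x)) => x.
by rewrite normrN; exact: sin_max.
Qed.

End sin_cos_bounds.

Lemma stein_sol_odd (R : realType) (b C : R) (h : R -> R) : 0 < b -> 0 <= C ->
  C.-lipschitz h -> (forall x, h (- x) = - h x) -> stein_sol b h 0 = 0.
Proof.
move=> b0 C0 hC h_odd; rewrite /stein_sol oppr0 /half_resolvent -mulrDr -mulrDr.
have -> : \int[lebesgue_measure]_(t in `]-oo, 0]) (expR (t / b) * (h \o -%R) t) =
    - \int[lebesgue_measure]_(t in `]-oo, 0]) (expR (t / b) * h t).
  rewrite -mulN1r -RintegralZl//; last exact: integrable_expRM C0 hC.
  by apply: eq_Rintegral => t _ /=; rewrite h_odd mulN1r mulrN.
by rewrite subrr !mulr0.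
Qed.

Section identically_distributed.
Context d (T : measurableType d) (R : realType) (P : probability T R).
Variables X Y : {RV P >-> R}.
Hypothesis XY : forall B : set R, measurable B -> P (X @^-1` B) = P (Y @^-1` B).

Let integral_distribution_eq (g : R -> \bar R) :
  (\int[distribution P X]_x g x = \int[distribution P Y]_x g x)%E.
Proof. by apply: eq_measure_integral => A mA _; exact: XY. Qed.

Lemma integrable_identical : P.-integrable [set: T] (EFin \o Y) ->
  P.-integrable [set: T] (EFin \o X).
Proof.
move=> /integrableP[_ iY]; apply/integrableP; split; first exact/measurable_EFinP.
have m_norm : measurable_fun [set: R] (fun x : R => `|x%:E|%E) by exact: measurableT_comp.
have := integral_distribution_eq (fun x => `|x%:E|%E).
by rewrite !ge0_integral_distribution// => ->.
Qed.

Lemma Rintegral_identical C (g : R -> R) : C.-lipschitz g ->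
  P.-integrable [set: T] (EFin \o Y) -> \int[P]_w g (X w) = \int[P]_w g (Y w).
Proof.
move=> gC int_Y; have mg : measurable_fun [set: R] (EFin \o g).
  by apply/measurable_EFinP; exact: klipschitz_measurable gC.
rewrite /Rintegral; congr fine.
have := integral_distribution_eq (EFin \o g); rewrite !integral_distribution//.
- exact: klipschitz_integrable gC int_Y.
- exact: klipschitz_integrable gC (integrable_identical int_Y).
Qed.

End identically_distributed.

Section trigonometric_moments.
Context d (T : measurableType d) (R : realType) (P : probability T R).
Variable X : {RV P >-> R}.
Hypothesis int_powX : forall n, P.-integrable [set: T] (EFin \o (fun w => `|X w| ^+ n)).

Lemma integrable_exprn n : P.-integrable [set: T] (EFin \o (fun w => X w ^+ n)).
Proof.
apply: (le_integrable _ _ _ (int_powX n)) => //.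
  by apply/measurable_EFinP; exact: measurable_funX.
by move=> w _ /=; rewrite lee_fin !normrX normr_id.
Qed.

Let int_X : P.-integrable [set: T] (EFin \o X).
Proof. exact: (integrable_exprn 1). Qed.

Let int_sin : P.-integrable [set: T] (EFin \o (sin \o X)).
Proof. exact: klipschitz_integrable klipschitz_sin int_X. Qed.

Let int_cos : P.-integrable [set: T] (EFin \o (cos \o X)).
Proof. exact: klipschitz_integrable klipschitz_cos int_X. Qed.

Lemma expect_cos_le1 : \int[P]_w cos (X w) <= 1.
Proof.
rewrite -[leRHS](Rintegral_cst_probability P); apply: le_Rintegral => //.
exact: finite_measure_integrable_cst.
Qed.

Lemma expect_cos_ge : 1 - 2^-1 * \int[P]_w (X w ^+ 2) <= \int[P]_w cos (X w).
Proof.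
have int_cst1 := finite_measure_integrable_cst P 1 measurableT.
have int_X2 := integrableZl measurableT 2^-1 (integrable_exprn 2).
rewrite -RintegralZl//; last exact: integrable_exprn.
rewrite -[X in X - _](Rintegral_cst_probability P) -RintegralB//.
apply: le_Rintegral => //; first exact: (integrableB measurableT int_cst1 int_X2).
by move=> w _; exact: cos_ge_quadratic.
Qed.

Hypothesis EX : \int[P]_w X w = 0.

Lemma expect_sin_le : `|\int[P]_w sin (X w)| <= 6^-1 * \int[P]_w (`|X w| ^+ 3).
Proof.
have int_rem := integrableB measurableT int_sin int_X.
rewrite -(subr0 (\int[P]_w sin _)) -EX -RintegralB// -RintegralZl//.
apply: ler_norm_Rintegral => [||w]; [exact: int_rem| |exact: sin_taylor1].
exact: (integrableZl measurableT 6^-1 (int_powX 3)).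
Qed.

Lemma expect_sin_taylor3 :
  `|\int[P]_w sin (X w) + 6^-1 * \int[P]_w (X w ^+ 3)|
    <= 120^-1 * \int[P]_w (`|X w| ^+ 5).
Proof.
have int_sinB := integrableB measurableT int_sin int_X.
have int_X3 := integrableZl measurableT 6^-1 (integrable_exprn 3).
rewrite -(subr0 (\int[P]_w sin _)) -EX -RintegralB//.
rewrite -RintegralZl//; last exact: integrable_exprn.
rewrite -RintegralD// -RintegralZl//.
apply: ler_norm_Rintegral => [||w]; last exact: sin_taylor3.
- exact: (integrableD measurableT int_sinB int_X3).
- exact: (integrableZl measurableT 120^-1 (int_powX 5)).
Qed.

End trigonometric_moments.

Section sine_of_random_sum.
Context d (T : measurableType d) (R : realType) (P : probability T R).
Variables (X : nat -> {RV P >-> R}) (N : T -> nat) (p : R).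
Hypothesis p01 : 0 < p < 1.
Hypothesis geoN : geometric_rv P N p.
Hypothesis indX : mutually_independent P (steps_and_index X N).
Hypothesis iidX : forall i (B : set R), measurable B -> P (X i @^-1` B) = P (X 0%N @^-1` B).
Hypothesis int_X0 : P.-integrable [set: T] (EFin \o X 0%N).

Let alpha := \int[P]_w cos (X 0%N w).
Let gamma := \int[P]_w sin (X 0%N w).

Let int_X i : P.-integrable [set: T] (EFin \o X i).
Proof. exact: integrable_identical (@iidX i) int_X0. Qed.

Let norm_X i : \int[P]_w `|X i w| <= \int[P]_w `|X 0%N w|.
Proof.
by rewrite (Rintegral_identical (@iidX i) klipschitz_norm int_X0).
Qed.

Let E_cos i : \int[P]_w cos (X i w) = alpha.
Proof. exact: (Rintegral_identical (@iidX i) klipschitz_cos int_X0). Qed.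

Let E_sin i : \int[P]_w sin (X i w) = gamma.
Proof. exact: (Rintegral_identical (@iidX i) klipschitz_sin int_X0). Qed.

Let int_cosX i := klipschitz_integrable (@klipschitz_cos R) (int_X i).
Let int_sinX i := klipschitz_integrable (@klipschitz_sin R) (int_X i).

Let shift_expect_sin i s : shift_expect P (X i) sin s = alpha * sin s + gamma * cos s.
Proof.
rewrite /shift_expect; under eq_Rintegral do rewrite sinD.
have int_l := integrableZl measurableT (sin s) (int_cosX i).
have int_r := integrableZl measurableT (cos s) (int_sinX i).
rewrite RintegralD// !RintegralZl// ?E_cos ?E_sin; first by ring.
- exact: int_sinX.
- exact: int_cosX.
Qed.

Let shift_expect_cos i s : shift_expect P (X i) cos s = alpha * cos s + - gamma * sin s.
Proof.
rewrite /shift_expect; under eq_Rintegral do rewrite cosD.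
have int_l := integrableZl measurableT (cos s) (int_cosX i).
have int_r := integrableZl measurableT (sin s) (int_sinX i).
rewrite RintegralB// !RintegralZl// ?E_cos ?E_sin; first by ring.
- exact: int_sinX.
- exact: int_cosX.
Qed.

(* With [q = 1 - p], the pair of [S = E sin] and [C = E cos] of the random sum
   solves [S = alpha q S + gamma (p + q C)] and [C = alpha (p + q C) - gamma q S]. *)
Lemma expect_sin_random_psum :
  \int[P]_w sin (random_psum X N w) *
    ((1 - (1 - p) * alpha) ^+ 2 + ((1 - p) * gamma) ^+ 2) = p * gamma.
Proof.
set S := \int[P]_w sin (random_psum X N w); set C := \int[P]_w cos (random_psum X N w).
have S_eq : S = alpha * (p * sin 0 + (1 - p) * S) + gamma * (p * cos 0 + (1 - p) * C).
  exact: (random_psum_linear_step p01 geoN indX int_X norm_X klipschitz_sin klipschitz_cos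
    shift_expect_sin).
have C_eq : C = alpha * (p * cos 0 + (1 - p) * C) + - gamma * (p * sin 0 + (1 - p) * S).
  exact: (random_psum_linear_step p01 geoN indX int_X norm_X klipschitz_cos klipschitz_sin
    shift_expect_cos).
rewrite sin0 cos0 mulr0 !add0r mulr1 in S_eq C_eq.
have S_lin : (1 - (1 - p) * alpha) * S = gamma * (p + (1 - p) * C).
  by rewrite mulrBl mul1r {1}S_eq; ring.
have C_lin : (1 - (1 - p) * alpha) * C = alpha * p - gamma * ((1 - p) * S).
  by rewrite mulrBl mul1r {1}C_eq; ring.
transitivity ((1 - (1 - p) * alpha) * ((1 - (1 - p) * alpha) * S) +
  S * ((1 - p) * gamma) ^+ 2); first by ring.
rewrite S_lin; transitivity (gamma * ((1 - (1 - p) * alpha) * p +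
  (1 - p) * ((1 - (1 - p) * alpha) * C)) + S * ((1 - p) * gamma) ^+ 2); first by ring.
by rewrite C_lin; ring.
Qed.

End sine_of_random_sum.

Lemma sine_equation_lower_bound (R : realFieldType) (p m alpha gamma S : R) :
  0 < p < 1 -> 0 <= m -> 1 - 2^-1 * (p * m) <= alpha <= 1 -> `|gamma| <= p ->
  S * ((1 - (1 - p) * alpha) ^+ 2 + ((1 - p) * gamma) ^+ 2) = p * gamma ->
  `|gamma| <= `|S| * (p * ((1 + m / 2) ^+ 2 + 1)).
Proof.
move=> /andP[p0 p1] m0 /andP[alpha_ge alpha_le] gamma_le S_eq.
set D := (1 - (1 - p) * alpha) ^+ 2 + ((1 - p) * gamma) ^+ 2 in S_eq.
have cos_part : (1 - (1 - p) * alpha) ^+ 2 <= (p * (1 + m / 2)) ^+ 2.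
  by rewrite lerXn2r ?nnegrE; nra.
have sin_part : ((1 - p) * gamma) ^+ 2 <= p ^+ 2.
  rewrite -real_normK ?num_real// lerXn2r ?nnegrE ?(ltW p0)// normrM ger0_norm; last lra.
  by apply: le_trans gamma_le; rewrite ler_piMl//; lra.
have D_ge0 : 0 <= D by rewrite addr_ge0 ?sqr_ge0.
rewrite -(ler_pM2l p0) -[X in X * `|gamma|](gtr0_norm p0) -normrM -S_eq normrM (ger0_norm D_ge0).
rewrite mulrCA ler_wpM2l//; apply: le_trans (lerD cos_part sin_part) _.
by rewrite le_eqVlt; apply/orP; left; apply/eqP; ring.
Qed.

Section scaled_moments.
Context d (T : measurableType d) (R : realType) (P : probability T R).
Variables (X : {RV P >-> R}) (k : R).
Hypothesis k_gt0 : 0 < k.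
Hypothesis int_powX : forall n, P.-integrable [set: T] (EFin \o (fun w => `|X w| ^+ n)).

Lemma integrable_norm_exprn_scale n :
  P.-integrable [set: T] (EFin \o (fun w => `|(k \o* X) w| ^+ n)).
Proof.
have := integrableZl measurableT (k ^+ n) (int_powX n).
congr (_.-integrable _ _); apply/funext => w.
by rewrite /= normrM (gtr0_norm k_gt0) exprMn mulrC EFinM.
Qed.

Lemma Rintegral_norm_exprn_scale n :
  \int[P]_w (`|(k \o* X) w| ^+ n) = k ^+ n * \int[P]_w (`|X w| ^+ n).
Proof.
rewrite -RintegralZl//; apply: eq_Rintegral => w _.
by rewrite normrM (gtr0_norm k_gt0) exprMn mulrC.
Qed.

Lemma Rintegral_exprn_scale n :
  \int[P]_w ((k \o* X) w ^+ n) = k ^+ n * \int[P]_w (X w ^+ n).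
Proof.
rewrite -RintegralZl//; last exact: integrable_exprn.
by apply: eq_Rintegral => w _; rewrite exprMn mulrC.
Qed.

End scaled_moments.

Section optimal_order.
Context d (T : measurableType d) (R : realType) (P : probability T R).
Variables (X : nat -> {RV P >-> R}) (N : T -> nat) (p : R).
Hypothesis p01 : 0 < p < 1.
Hypothesis geoN : geometric_rv P N p.
Hypothesis indX : mutually_independent P (steps_and_index X N).
Hypothesis iidX : forall i (B : set R), measurable B -> P (X i @^-1` B) = P (X 0%N @^-1` B).
Hypothesis int_powX :
  forall n, P.-integrable [set: T] (EFin \o (fun w => `|X 0%N w| ^+ n)).
Hypothesis EX : \int[P]_w X 0%N w = 0.

Let k := Num.sqrt p.
Let Y := scaled_steps X k.
Let m2 := \int[P]_w (X 0%N w ^+ 2).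
Let m3 := \int[P]_w (X 0%N w ^+ 3).
Let a3 := \int[P]_w (`|X 0%N w| ^+ 3).
Let a5 := \int[P]_w (`|X 0%N w| ^+ 5).

Let p_gt0 : 0 < p. Proof. by case/andP: p01. Qed.
Let k_gt0 : 0 < k. Proof. by rewrite sqrtr_gt0. Qed.
Let sqr_k : k ^+ 2 = p. Proof. by rewrite sqr_sqrtr// ltW. Qed.

Let iidY i (B : set R) : measurable B -> P (Y i @^-1` B) = P (Y 0%N @^-1` B).
Proof.
move=> mB; apply: (@iidX i ((fun x => x * k) @^-1` B)).
by rewrite -[X in measurable X]setTI; exact: measurable_funM.
Qed.

Let int_powY n : P.-integrable [set: T] (EFin \o (fun w => `|Y 0%N w| ^+ n)).
Proof. exact: integrable_norm_exprn_scale. Qed.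

Let EY : \int[P]_w Y 0%N w = 0.
Proof. by have := Rintegral_exprn_scale k int_powX 1; rewrite EX mulr0. Qed.

Lemma expect_sin_random_sum_ge : k * a3 <= 6 -> p * a5 <= 10 * `|m3| ->
  `|m3| / (12 * ((1 + m2 / 2) ^+ 2 + 1)) * k <=
  `|\int[P]_w sin (random_psum Y N w)|.
Proof.
move=> ka3 pa5.
pose gamma := \int[P]_w sin (Y 0%N w).
have m2_ge0 : 0 <= m2 by apply: Rintegral_ge0 => w _; exact: sqr_ge0.
have EY2 : \int[P]_w (Y 0%N w ^+ 2) = p * m2 by rewrite Rintegral_exprn_scale// sqr_k.
have EY3 : \int[P]_w (Y 0%N w ^+ 3) = p * k * m3.
  by rewrite Rintegral_exprn_scale// exprSr sqr_k.
have EY3_norm : \int[P]_w (`|Y 0%N w| ^+ 3) = p * k * a3.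
  by rewrite Rintegral_norm_exprn_scale// exprSr sqr_k.
have EY5_norm : \int[P]_w (`|Y 0%N w| ^+ 5) = p * k * (p * a5).
  by rewrite Rintegral_norm_exprn_scale// -/a5 -sqr_k; ring.
have gamma_le : `|gamma| <= p.
  apply: le_trans (expect_sin_le int_powY EY) _.
  rewrite EY3_norm -mulrA mulrCA ler_piMr ?(ltW p_gt0)//.
  by rewrite ler_pdivrMl// mulr1.
have gamma_ge : 12^-1 * (p * k * `|m3|) <= `|gamma|.
  have := expect_sin_taylor3 int_powY EY; rewrite EY3 EY5_norm -/gamma => taylor.
  have pk_gt0 : 0 < p * k by exact: mulr_gt0.
  have : p * k * (p * a5) <= p * k * (10 * `|m3|) by rewrite ler_pM2l.
  have : 6^-1 * (p * k * `|m3|) <= `|gamma| + `|gamma + 6^-1 * (p * k * m3)|.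
    have <- : `|6^-1 * (p * k * m3)| = 6^-1 * (p * k * `|m3|).
      by rewrite 2!normrM (gtr0_norm pk_gt0) ger0_norm.
    by rewrite (le_trans _ (ler_normB _ _))// opprD addrA subrr sub0r normrN.
  by rewrite -[p * k * (10 * _)]mulrCA; lra.
have alpha_bounds : 1 - 2^-1 * (p * m2) <= \int[P]_w cos (Y 0%N w) <= 1.
  by rewrite -EY2 expect_cos_ge// expect_cos_le1.
have := sine_equation_lower_bound p01 m2_ge0 alpha_bounds gamma_le
  (expect_sin_random_psum p01 geoN (mutually_independent_scaled_steps k indX) iidY
    (integrable_exprn int_powY 1)).
set S := `|\int[P]_w sin _|; set K := (1 + m2 / 2) ^+ 2 + 1 => S_ge.
have K_gt0 : 0 < K by rewrite ltr_wpDl ?sqr_ge0.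
rewrite mulrAC ler_pdivrMr ?mulr_gt0// -(ler_pM2l p_gt0).
have := le_trans gamma_ge S_ge.
have -> : S * (p * K) = p * (S * K) by ring.
have -> : 12^-1 * (p * k * `|m3|) = p * (`|m3| * k / 12) by field.
by rewrite !ler_pM2l//; lra.
Qed.

End optimal_order.

Lemma dW_laplace_random_sum_ge d (T : measurableType d) (R : realType)
    (P : probability T R) (X : nat -> {RV P >-> R}) (b : R) : 0 < b ->
  (forall i (B : set R), measurable B -> P (X i @^-1` B) = P (X 0%N @^-1` B)) ->
  'E_P[X 0%N] = 0%E ->
  (forall n : nat, P.-integrable setT (fun w => (`|X 0%N w| ^+ n)%:E)) ->
  'E_P[fun w => (X 0%N w ^+ 3)%R] != 0%E ->
  exists c : R, 0 < c /\ exists p0 : R, 0 < p0 /\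
    forall (p : R) (N : T -> nat), 0 < p -> p < p0 -> p < 1 ->
      geometric_rv P N p ->
      mutually_independent P (steps_and_index X N) ->
      ((c * Num.sqrt p)%:E <=
         dW_laplace P (random_sum (fun i => X i : T -> R) N p) b)%E.
Proof.
move=> b_gt0 iidX EX0 int_powX EX3.
have RX0 : \int[P]_w X 0%N w = 0.
  by apply: EFin_inj; rewrite -expectation_Rintegral ?EX0//; exact: (integrable_exprn int_powX 1).
pose m2 := \int[P]_w (X 0%N w ^+ 2).
pose m3 := \int[P]_w (X 0%N w ^+ 3).
pose a3 := \int[P]_w (`|X 0%N w| ^+ 3).
pose a5 := \int[P]_w (`|X 0%N w| ^+ 5).
have a3_ge0 : 0 <= a3 by apply: Rintegral_ge0 => w _; exact: exprn_ge0.
have a5_ge0 : 0 <= a5 by apply: Rintegral_ge0 => w _; exact: exprn_ge0.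
have a3_gtN1 : 0 < a3 + 1 by rewrite ltr_wpDl.
have a5_gtN1 : 0 < a5 + 1 by rewrite ltr_wpDl.
have m3_gt0 : 0 < `|m3|.
  rewrite normr_gt0; apply: contra_neq EX3 => m3_eq0.
  by rewrite expectation_Rintegral ?[\int[P]_w _]m3_eq0//; exact: integrable_exprn.
exists (`|m3| / (12 * ((1 + m2 / 2) ^+ 2 + 1))); split.
  by rewrite divr_gt0// mulr_gt0// ltr_wpDl ?sqr_ge0.
exists (Num.min ((a3 + 1)^-1 ^+ 2) (`|m3| / (a5 + 1))); split.
  by rewrite lt_min exprn_gt0 ?invr_gt0// divr_gt0.
move=> p N p_gt0; rewrite lt_min => /andP[p_lt_a3 p_lt_a5] p_lt1 geoN indX.
have p01 : 0 < p < 1 by rewrite p_gt0.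
set Y := scaled_steps X (Num.sqrt p).
have int_sin : P.-integrable [set: T] (EFin \o (sin \o random_psum Y N)).
  apply: (integrable_bounded _ (M := 1)) => [|w]; last exact: sin_max.
  apply: (measurableT_comp (klipschitz_measurable (@klipschitz_sin R))).
  exact: measurable_random_psum geoN.1.
rewrite random_sumE; apply: le_trans (dW_laplace_ge_test b_gt0 (@klipschitz_sin R) int_sin).
rewrite (stein_sol_odd b_gt0 ler01 (@klipschitz_sin R) (@sinN R)) subr0 lee_fin.
apply: (expect_sin_random_sum_ge p01 geoN indX iidX int_powX RX0).
- have sqrt_le : Num.sqrt p * (a3 + 1) <= 1.
    rewrite -ler_pdivlMr// mul1r -[leRHS]ger0_norm ?invr_ge0 ?(ltW a3_gtN1)// -sqrtr_sqr.
    by rewrite ler_sqrt ?sqr_ge0// ltW.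
  by have := sqrtr_ge0 p; rewrite -/a3; nra.
- by move: p_lt_a5; rewrite ltr_pdivlMr// -/a5 -/m3; nra.
Qed.

Unset Implicit Arguments.

Theorem theorem5p10 (R : realType) (d : measure_display) (T : measurableType d)
    (P : probability T R) :
  (* Kolmogorov and Wasserstein upper bounds *)
  (forall (X : nat -> {RV P >-> R}) (sigma p : R) (N : T -> nat)
      (L : nat -> probability R R),
    0 < sigma -> 0 < p < 1 ->
    (forall i, 'E_P[X i] = 0%E) ->
    (forall i, 'E_P[fun w => (X i w ^+ 2)%R] = (sigma ^+ 2)%:E) ->
    geometric_rv P N p ->
    mutually_independent P
      (fun o : option nat => match o with
                             | None => fun w => (N w)%:R
                             | Some i => (X i : T -> R) end) ->
    (forall i, equilibrium_law P (X i) (L i)) ->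
    let W := random_sum (fun i => (X i : T -> R)) N p in
    let b := sigma / Num.sqrt 2 in
    let rho := ereal_sup (range (fun i => 'E_P[fun w => (`|X i w| ^+ 3)%R])) in
    (dK_laplace P W b <=
       (1704 / 100 * Num.sqrt p / sigma)%:E *
       ereal_sup [set e | exists (i : nat) (u : R), (0 < u < 1)%R /\
         e = (`|gen_inv (cdf_rv P (X i)) u - gen_inv (cdf_law (L i)) u|)%:E])%E /\
    ((rho < +oo)%E ->
     (dW_laplace P W b <=
        (12 * Num.sqrt p)%:E * (sigma%:E + rho * ((3 * sigma ^+ 2)^-1)%:E))%E)) /\
  (* optimality of the order p^{1/2} *)
  (forall (X : nat -> {RV P >-> R}) (sigma : R),
    0 < sigma ->
    mutually_independent P (fun i => (X i : T -> R)) ->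
    (forall i (B : set R), measurable B -> P (X i @^-1` B) = P (X 0%N @^-1` B)) ->
    'E_P[X 0%N] = 0%E ->
    'E_P[fun w => (X 0%N w ^+ 2)%R] = (sigma ^+ 2)%:E ->
    (forall n : nat, P.-integrable setT (fun w => (`|X 0%N w| ^+ n)%:E)) ->
    'E_P[fun w => (X 0%N w ^+ 3)%R] != 0%E ->
    exists c : R, 0 < c /\ exists p0 : R, 0 < p0 /\
      forall (p : R) (N : T -> nat), 0 < p -> p < p0 -> p < 1 ->
        geometric_rv P N p ->
        mutually_independent P
          (fun o : option nat => match o with
                                 | None => fun w => (N w)%:R
                                 | Some i => (X i : T -> R) end) ->
        ((c * Num.sqrt p)%:E <=
           dW_laplace P (random_sum (fun i => (X i : T -> R)) N p)
             (sigma / Num.sqrt 2))%E).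
Proof.
split.
- move=> X sigma p N L sigma_gt0 p01 EX EX2 geoN indX eqL W b rho; split.
    exact: dK_laplace_random_sum_le.
  exact: dW_laplace_random_sum_le.
- move=> X sigma sigma_gt0 _ iidX EX _ int_powX EX3.
  by apply: dW_laplace_random_sum_ge => //; rewrite divr_gt0// sqrtr_gt0.
Qed.
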